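(* Let $p\geq 3$ be prime and $t\geq 3$. Let $\mathcal{A}_{t,p}$ be the number of nonequivalent $\mathbb{Z}_{p^s}$-linear GH codes of length $p^t$ (over all $s\geq1$), and $\mathcal{A}_{t,s,p}$ the number of nonequivalent $\mathbb{Z}_{p^s}$-linear GH codes of length $p^t$ for fixed $s$. For $s\geq 2$ let $\tilde{X}_{t,s,p}=|\{(t_1,\dots,t_s)\in\mathbb{N}^s: t+1=\sum_{i=1}^s(s-i+1)t_i,\ t_1\geq 2\}|$. Then $$\mathcal{A}_{t,p}\leq 1+\sum_{s=2}^{\lfloor (t+1)/2\rfloor}\tilde{X}_{t,s,p}\quad\text{and}\quad \mathcal{A}_{t,p}\leq 1+\sum_{s=2}^{\lfloor (t+1)/2\rfloor}(\mathcal{A}_{t,s,p}-1).$$ Moreover, for $3\leq t\leq 10$ the first upper bound is tight, i.e. $\mathcal{A}_{t,p}=1+\sum_{s=2}^{\lfloor (t+1)/2\rfloor}\tilde{X}_{t,s,p}$.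
   Context: For $s\geq 1$ and $u\in\mathbb{Z}_{p^s}$ with $p$-ary expansion $u=\sum_{i=0}^{s-1}u_ip^i$, $u_i\in\{0,\dots,p-1\}$, the Gray map $\phi_s:\mathbb{Z}_{p^s}\to\mathbb{Z}_p^{p^{s-1}}$ is $\phi_s(u)=(u_{s-1},\dots,u_{s-1})+(u_0,\dots,u_{s-2})Y_{s-1}$, where $Y_{s-1}$ is an $(s-1)\times p^{s-1}$ matrix whose columns are exactly the elements of $\mathbb{Z}_p^{s-1}$; $\phi_1$ is the identity. $\Phi_s$ applies $\phi_s$ coordinatewise and concatenates. For $1\le i\le s$ let $T_i=\{jp^{i-1}: 0\le j\le p^{s-i+1}-1\}\subseteq\mathbb{Z}_{p^s}$. For nonnegative integers $t_1\geq1,t_2,\dots,t_s$, $A^{t_1,\dots,t_s}$ is the matrix over $\mathbb{Z}_{p^s}$ whose columns are all vectors $\mathbf{z}^T$ with $\mathbf{z}\in\{1\}\times T_1^{t_1-1}\times T_2^{t_2}\times\cdots\times T_s^{t_s}$; $\mathcal{H}^{t_1,\dots,t_s}$ is the subgroup generated by its rows and $H^{t_1,\dots,t_s}=\Phi_s(\mathcal{H}^{t_1,\dots,t_s})$ is the $\mathbb{Z}_{p^s}$-linear GH code; it has length $p^t$ where $t=\sum_{i=1}^s(s-i+1)t_i-1$. The $\mathbb{Z}_{p^s}$-linear GH codes of length $p^t$ are the codes $H^{t_1,\dots,t_s}$ with this value of $t$. Two codes $C_1,C_2\subseteq\mathbb{Z}_p^N$ are equivalent if $C_2=\{\mathbf{a}+\pi(\mathbf{c}):\mathbf{c}\in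 C_1\}$ for some $\mathbf{a}\in\mathbb{Z}_p^N$ and coordinate permutation $\pi$. *)

(* Defs.v *)
From HB Require Import structures.
From mathcomp Require Import all_boot all_order fingroup perm all_algebra.
Set Implicit Arguments. Unset Strict Implicit. Unset Printing Implicit Defensive.
Import GRing.Theory.
Local Open Scope ring_scope.

Definition digit (p u i : nat) : nat := ((u %/ p ^ i) %% p)%N.

(* Coordinate j (0 <= j < p^(s-1)) of the Gray map phi_s(u), for u < p^s.
   Column j of Y_{s-1} is the vector of the first s-1 p-ary digits of j,
   so the columns of Y_{s-1} are exactly the elements of Z_p^{s-1}. *)
Definition gray (p s u j : nat) : nat :=
  ((digit p u s.-1 + \sum_(i < s.-1) digit p u i * digit p j i) %% p)%N.

(* ts = [:: t_1; ...; t_s].  Level (1-based i) of each row of A^{t_1,...,t_s}: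
   t_1 rows of level 1, t_2 rows of level 2, ... *)
Definition lvls (ts : seq nat) : seq nat :=
  flatten (mkseq (fun i => nseq (nth 0%N ts i) i.+1) (size ts)).

(* The set of columns of A^{ts} : vectors z over Z_{p^s} (s = size ts) with
   z_0 = 1 and z_k in T_{level k} = p^(level k - 1) Z_{p^s} for k >= 1. *)
Definition colset (p : nat) (ts : seq nat) :
  {set {ffun 'I_(sumn ts) -> 'I_(p ^ size ts)}} :=
  [set z : {ffun 'I_(sumn ts) -> 'I_(p ^ size ts)} | [forall k : 'I_(sumn ts),
     if val k == 0%N then val (z k) == 1%N
     else (p ^ (nth 0%N (lvls ts) k).-1 %| z k)%N]].

(* The Z_{p^s}-linear GH code H^{ts} = Phi_s(span of rows of A^{ts}), as a set
   of words of length p^t over Z_p.  Word coordinate k corresponds to column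
   number k %/ p^(s-1) of A (in the enumeration order of colset) and to
   position k %% p^(s-1) inside the Gray image of that coordinate. *)
Definition GHcode (p t : nat) (ts : seq nat) : {set {ffun 'I_(p ^ t) -> 'Z_p}} :=
  let s := size ts in
  let r := sumn ts in
  let cols := [seq (fun k : 'I_r => val (z k)) | z : {ffun 'I_(sumn ts) -> 'I_(p ^ size ts)} <- enum (colset p ts)] in
  [set [ffun k : 'I_(p ^ t) =>
         ((gray p s
             ((\sum_(i < r) val (lam i) * nth (fun _ => 0%N) cols (k %/ p ^ s.-1) i)
                %% p ^ s)
             (k %% p ^ s.-1))%:R : 'Z_p)]
  | lam : {ffun 'I_r -> 'I_(p ^ s)}].

Definition code_equiv (p N : nat) (C1 C2 : {set {ffun 'I_N -> 'Z_p}}) : bool :=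
  [exists a : {ffun 'I_N -> 'Z_p}, exists pi : {perm 'I_N},
     C2 == [set a + [ffun k => c (pi k)] | c : {ffun 'I_N -> 'Z_p} in C1]].

Definition nclasses (p N : nat) (F : {set {set {ffun 'I_N -> 'Z_p}}}) : nat :=
  #|[set [set D in F | code_equiv C D] | C in F]|.

Definition weight (ts : seq nat) : nat :=
  (\sum_(i < size ts) (size ts - i) * nth 0 ts i)%N.

(* The Z_{p^s}-linear GH codes of length p^t: H^{t_1..t_s} with t_1 >= 1 and
   weight = t + 1.  Each t_i is at most t+1, so ranging over 'I_(t+2) loses
   nothing. *)
Definition GHfam (p t s : nat) : {set {set {ffun 'I_(p ^ t) -> 'Z_p}}} :=
  [set C | [exists ts : s.-tuple 'I_(t + 2),
     [&& (1 <= nth 0 (map val ts) 0)%N, weight (map val ts) == t.+1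
       & C == GHcode p t (map val ts)]]].

(* All Z_{p^s}-linear GH codes of length p^t, over all s >= 1
   (s <= t+1 is automatic since weight >= s * t_1 >= s). *)
Definition GHfam_all (p t : nat) : {set {set {ffun 'I_(p ^ t) -> 'Z_p}}} :=
  [set C | [exists s : 'I_(t + 2), (0 < s)%N && (C \in GHfam p t s)]].

Definition A_ts (p t s : nat) : nat := nclasses (GHfam p t s).
Definition A_t (p t : nat) : nat := nclasses (GHfam_all p t).

Definition Xtilde (t s : nat) : nat :=
  #|[set ts : s.-tuple 'I_(t + 2) |
      (2 <= nth 0 (map val ts) 0)%N && (weight (map val ts) == t.+1)]|.

(* Main.v *)
Require Import Defs.
From mathcomp Require Import all_boot all_order fingroup perm all_algebra.
From mathcomp Require Import zify.
Set Implicit Arguments. Unset Strict Implicit. Unset Printing Implicit Defensive.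
Import GRing.Theory.

(** A coordinate of the code is a pair [(z, y)] of a column [z] and a position
    [y < p ^ (s - 1)], and the codeword of [lam] takes there the value
    [u_(s-1) + sum_(i < s-1) u_i y_i], where the [u_i] are the digits of
    [u = sum_k lam_k z_k].

    Upper bound: if [t_1 = 1], the lowest digit of [u] is the same at all
    coordinates, so the lowest digit of [y] may be traded for a row of order
    [p]. Hence [H^(1,t_2,...,t_s)] is equivalent to
    [H^(t_2+1,t_3,...,t_s+1)] (to [H^(t_2+2)] if [s = 2]), and iterating, every
    code is equivalent to a canonical one, with [t_1 >= 2] or [s = 1].

    Lower bound: start from the full relation on the coordinates and refine it
    repeatedly, separating two points of a class when some element of the kernel
    of the code restricted to that class takes different values at them. This
    construction is invariant under equivalence. For a canonical code, the
    [j]-th relation is congruence of each [z_k] modulo [p ^ (l_k + j)], with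
    [p ^ l_k] the generator of the range of row [k], and of [y] modulo
    [p ^ (j - 1)]: adding two codewords adds digits without carry, codewords are
    affine along lines of columns, and for [p >= 3] a nonconstant carry along
    such a line is never affine. The class sizes then determine
    [(t_1,...,t_s)], for every [t]. *)

(** * Digits in base p *)

Section DigitArithmetic.
Variable p : nat.
Hypothesis p_gt1 : 1 < p.

Lemma expnp_gt0 i : 0 < p ^ i.
Proof. by rewrite expn_gt0 (ltn_trans _ p_gt1). Qed.
Hint Resolve expnp_gt0 : core.

Lemma p_gt0 : 0 < p. Proof. exact: ltn_trans p_gt1. Qed.
Hint Resolve p_gt0 : core.

Lemma ltn_digit N i : digit p N i < p.
Proof. by rewrite ltn_mod. Qed.

Lemma digit_mod N s i : i < s -> digit p (N %% p ^ s) i = digit p N i.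
Proof.
move=> lt_is; rewrite /digit {2}(divn_eq N (p ^ s)).
rewrite -{3}(subnK (ltnW lt_is)) expnD mulnA divnMDl //.
by rewrite -modnDml -modnMmr -(subnSK lt_is) expnS modnMr muln0 mod0n add0n.
Qed.

Lemma digit_eqmod N M s i : N = M %[mod p ^ s] -> i < s -> digit p N i = digit p M i.
Proof. by move=> e lt_is; rewrite -(digit_mod N lt_is) e digit_mod. Qed.

Lemma modn_expnS N i : N %% p ^ i.+1 = digit p N i * p ^ i + N %% p ^ i.
Proof.
rewrite {1}(divn_eq N (p ^ i)) {1}(divn_eq (N %/ p ^ i) p) mulnDl -mulnA -expnS.
rewrite -addnA modnMDl modn_small // expnS.
have := ltn_digit N i; have := ltn_pmod N (expnp_gt0 i).
rewrite /digit; set a := N %% _; set b := _ %% p; set q := p ^ i; nia.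
Qed.

Lemma eqmod_expnS N M i : N = M %[mod p ^ i] -> digit p N i = digit p M i ->
  N = M %[mod p ^ i.+1].
Proof. by move=> e d; rewrite !modn_expnS e d. Qed.

Lemma eqmod_expn_le N M i j : i <= j -> N = M %[mod p ^ j] -> N = M %[mod p ^ i].
Proof.
move=> le_ij e; have d : p ^ i %| p ^ j by rewrite dvdn_exp2l.
by rewrite -(modn_dvdm N d) e modn_dvdm.
Qed.

Lemma eqmod_digits N M i : (forall k, k < i -> digit p N k = digit p M k) ->
  N = M %[mod p ^ i].
Proof.
elim: i => [|i IH] h; first by rewrite !modn1.
by apply: eqmod_expnS; [apply: IH => k /ltnW/h | apply: h].
Qed.

Lemma digit_small N i j : N < p ^ i -> i <= j -> digit p N j = 0.
Proof.
move=> ltN le_ij; rewrite /digit divn_small ?mod0n //.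
by apply: leq_trans ltN _; rewrite leq_exp2l.
Qed.

Lemma digit_addM N q i : digit p (N + p ^ i * q) i = (digit p N i + q) %% p.
Proof. by rewrite /digit mulnC addnC divnMDl // modnDml addnC. Qed.

Lemma digit_addM_lt N q i k : k < i -> digit p (N + p ^ i * q) k = digit p N k.
Proof. by move=> ki; apply: (@digit_eqmod _ _ i) => //; rewrite addnC mulnC modnMDl. Qed.

Lemma digit_div N i : digit p (N %/ p) i = digit p N i.+1.
Proof. by rewrite /digit -divnMA expnS. Qed.

(** Adding multiples on both sides avoids truncated subtraction and turns congruences into equations
    for [lia]. *)
Lemma eqmod_exP a b m : (exists k l, a + k * m = b + l * m) <-> a = b %[mod m].
Proof.
split=> [[k [l e]]|e]; first by rewrite -(modnMDl k a) addnC e addnC modnMDl.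
exists (b %/ m), (a %/ m).
by rewrite {1}(divn_eq a m) {2}(divn_eq b m) e; lia.
Qed.

(* The carries [c] of the digitwise sum satisfy [c 0 + c 2 = 2 * c 1] modulo [p],
   which for bits and [p > 2] forces them to be equal. *)
Lemma three_term_carry (A B G : nat -> nat) kap : 2 < p ->
  (A 0 + A 2 = 2 * A 1 %[mod p ^ 2]) ->
  (B 0 + B 2 = 2 * B 1 %[mod p ^ 2]) ->
  (G 0 + G 2 = 2 * G 1 %[mod p ^ 2]) ->
  (forall i, i < 3 -> G i = A i + B i %[mod p]) ->
  (forall i, i < 3 -> digit p (G i) 1 = digit p (A i) 1 + digit p (B i) 1 + kap %[mod p]) ->
  (p <= A 1 %% p + B 1 %% p) = (p <= A 2 %% p + B 2 %% p).
Proof.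
move=> p_gt2 /eqmod_exP[a1 [a2 ea]] /eqmod_exP[b1 [b2 eb]] /eqmod_exP[g1 [g2 eg]] h0 h1.
(* Modulo [p ^ 2], [G i] falls short of [A i + B i + p * kap] by [p] times the carry out of the
   lowest digit. *)
have key i : i < 3 -> exists k l, G i + p * (p <= A i %% p + B i %% p) + k * p ^ 2 =
   A i + B i + p * kap + l * p ^ 2.
  move=> i3; have /eqmod_exP[x [y {h1}]] := h1 _ i3; have := h0 _ i3; rewrite {}modnD //.
  rewrite /digit !expn1 -mulnn => {}h0.
  have := divn_eq (G i) p; have := divn_eq (A i) p; have := divn_eq (B i) p.
  have := divn_eq (G i %/ p) p; have := divn_eq (A i %/ p) p; have := divn_eq (B i %/ p) p.
  have {}h0 : G i %% p + p * (p <= A i %% p + B i %% p) = A i %% p + B i %% p.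
    move: h0; case: leqP => hc ->; last by rewrite muln0 addn0 mul0n subn0.
    by rewrite muln1 mul1n subnK.
  move: (_ <= _) h0 => c h0; move: h0.
  move: (G i %/ p %/ p) (A i %/ p %/ p) (B i %/ p %/ p) => u1 u2 u3.
  move: (G i %/ p %% p) (A i %/ p %% p) (B i %/ p %% p) => v1 v2 v3.
  move: (G i %/ p) (A i %/ p) (B i %/ p) => w1 w2 w3.
  move: (G i %% p) (A i %% p) (B i %% p) => r1 r2 r3 h0 -> -> -> -> -> -> e7.
  exists (x + u2 + u3), (y + u1); move: (nat_of_bool c) h0 => {}c h0.
  have {}e7 := congr1 (fun n => n * p) e7; clear -h0 e7; move: e7 => /= e7; lia.
have [k0 [l0 e0]] := key 0 isT.
have [k1 [l1 e1]] := key 1 isT.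
have [k2 [l2 e2]] := key 2 isT.
move: e0 e1 e2; set c0 := p <= A 0 %% p + _; set c1 := p <= _; set c2 := p <= _.
move: c0 c1 c2 => c0 c1 c2 e0 e1 e2.
(* Adding [key] at 0 and 2 and subtracting it twice at 1 cancels all but the carries times [p]; that
   factor is then divided out. *)
have e : c0 + c2 = 2 * c1 %[mod p].
  apply/eqmod_exP; exists (g2 + k0 + k2 + a1 + b1 + 2 * l1), (g1 + 2 * k1 + a2 + b2 + l0 + l2).
  apply/eqP; rewrite -(eqn_pmul2l p_gt0); apply/eqP.
  rewrite -mulnn in ea eb eg e0 e1 e2.
  move: (nat_of_bool c0) (nat_of_bool c1) (nat_of_bool c2) e0 e1 e2 => {}c0 {}c1 {}c2 e0 e1 e2.
  move: (A 0) (A 1) (A 2) (B 0) (B 1) (B 2) (G 0) (G 1) (G 2) ea eb eg e0 e1 e2.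
  move=> A0 A1 A2 B0 B1 B2 G0 G1 G2 ea eb eg e0 e1 e2; clear -ea eb eg e0 e1 e2; lia.
by move: e; case: (c0); case: (c1); case: (c2) => //=; rewrite ?modn_small //.
Qed.

End DigitArithmetic.

(** * Coordinates of the codes *)

Fixpoint lvls_from (i : nat) (ts : seq nat) : seq nat :=
  if ts is x :: u then nseq x i ++ lvls_from i.+1 u else [::].

Lemma lvlsE ts : lvls ts = lvls_from 1 ts.
Proof.
rewrite /lvls /mkseq; have: forall m n, flatten [seq nseq (nth 0 ts (i - m)) (i + n).+1
    | i <- iota m (size ts)] = lvls_from (m + n).+1 ts.
  elim: ts => //= x u IH m n; rewrite subnn; congr (_ ++ _).
  rewrite -addSn -IH; congr flatten; apply/eq_in_map => i.
  rewrite mem_iota => /andP[lt_mi _].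
  by rewrite -(subnSK lt_mi).
move=> /(_ 0 0) <-; congr flatten; apply: eq_map => i.
by rewrite subn0 addn0.
Qed.

Lemma size_lvls ts : size (lvls ts) = sumn ts.
Proof.
rewrite lvlsE; elim: ts 1 => //= x u IH i.
by rewrite size_cat size_nseq IH.
Qed.

Lemma sum_lvls (f : nat -> nat) ts :
  \sum_(l <- lvls ts) f l = \sum_(i < size ts) nth 0 ts i * f i.+1.
Proof.
rewrite lvlsE; have: forall m, \sum_(l <- lvls_from m.+1 ts) f l =
    \sum_(i < size ts) nth 0 ts i * f (m + i).+1; last by move=> ->.
elim: ts => [|x u IH] m /=; first by rewrite big_nil big_ord0.
rewrite big_cat big_ord_recl IH /= big_nseq iter_addn_0 mulnC addn0.
by congr (_ + _); apply: eq_bigr => i _; rewrite addnS.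
Qed.

Lemma lvls_range ts l : l \in lvls ts -> 0 < l <= size ts.
Proof.
rewrite lvlsE -[size ts]add0n; elim: ts 0 => //= x u IH i.
rewrite mem_cat mem_nseq => /orP[/andP[_ /eqP->]|/IH]; first by lia.
by lia.
Qed.

Lemma nth_lvls_head ts k : k < nth 0 ts 0 -> nth 0 (lvls ts) k = 1.
Proof.
by rewrite lvlsE; case: ts => //= x u lt_kx; rewrite nth_cat size_nseq lt_kx nth_nseq lt_kx.
Qed.

(* Zero-based: row [k] takes its values in the multiples of [p ^ lev ts k]. *)
Definition lev (ts : seq nat) k := (nth 0 (lvls ts) k).-1.

Lemma lev_lt ts k : k < sumn ts -> lev ts k < size ts.
Proof.
move=> lt_k; have /lvls_range/andP[] : nth 0 (lvls ts) k \in lvls ts.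
  by rewrite mem_nth ?size_lvls.
by rewrite /lev; case: nth.
Qed.

Lemma lev0 ts k : k < nth 0 ts 0 -> lev ts k = 0.
Proof. by rewrite /lev => /nth_lvls_head ->. Qed.

Lemma sum_lev (f : nat -> nat) ts :
  \sum_(k < sumn ts) f (lev ts k) = \sum_(i < size ts) nth 0 ts i * f i.
Proof.
rewrite -(sum_lvls (fun l => f l.-1)) (big_nth 0) size_lvls big_mkord.
by apply: eq_bigr.
Qed.

(* The Gray map of [Defs], with values in ['Z_p] and with only the digits of
   [N] below [s] taken into account. *)
Definition gr p s (N y : nat) : 'Z_p :=
  ((digit p N s.-1)%:R + \sum_(i < s.-1) (digit p N i)%:R * (digit p y i)%:R)%R.

(** For [e > s] the exponent truncates to 0, rightly so: [c < p ^ s] is then the only solution. *)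
Lemma card_eqmod p s c e : 1 < p -> c < p ^ s ->
  #|[set x : 'I_(p ^ s) | x == c %[mod p ^ e]]| = p ^ (s - e).
Proof.
move=> p1 ltc; have P0 := expnp_gt0 p1.
case: (leqP e s) => [les|lts]; last first.
  have -> : s - e = 0 by lia.
  rewrite expn0; apply/eqP/cards1P; exists (Ordinal ltc); apply/setP => x.
  rewrite !inE; apply/eqP/eqP => [|->] // h; apply: val_inj => /=.
  have lt x' : x' < p ^ s -> x' < p ^ e by move=> h'; apply: leq_trans h' _; rewrite leq_exp2l // ltnW.
  by move: h; rewrite !modn_small ?lt.
have lt_f (q : 'I_(p ^ (s - e))) : c %% p ^ e + p ^ e * q < p ^ s.
  have := ltn_pmod c (P0 e); have := ltn_ord q.
  rewrite (_ : p ^ s = p ^ e * p ^ (s - e)); last by rewrite -expnD subnKC.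
  move: (nat_of_ord q) => q'; move: (p ^ (s - e)) (c %% p ^ e) => d a; move: (p ^ e) => b; nia.
pose f q := Ordinal (lt_f q).
have f_inj : injective f.
  move=> q q' /(congr1 val) /= /eqP.
  by rewrite eqn_add2l eqn_pmul2l // => /eqP /val_inj.
rewrite -[RHS]card_ord -cardsT -(card_imset _ f_inj); congr #|pred_of_set _|.
apply/setP => x; rewrite inE; apply/eqP/imsetP => [e'|[q _ ->]] /=; last first.
  by rewrite mulnC addnC modnMDl modn_mod.
have ltq : x %/ p ^ e < p ^ (s - e).
  by rewrite ltn_divLR // -expnD subnK.
exists (Ordinal ltq) => //; apply: val_inj => /=.
by rewrite -e' addnC mulnC -divn_eq.
Qed.

Lemma ltn_mulD i y a b : i < a -> y < b -> i * b + y < a * b.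
Proof. by move=> lta ltb; nia. Qed.

Section Coordinates.
Variables (p t : nat) (ts : seq nat).
Hypothesis p_gt1 : 1 < p.
Hypothesis ts_head : 0 < nth 0 ts 0.
Hypothesis ts_weight : weight ts = t.+1.

Notation s := (size ts).
Notation r := (sumn ts).
Notation lv := (lev ts).

Let P0 := expnp_gt0 p_gt1.

Lemma size_ts_gt0 : 0 < s. Proof. by case: ts ts_head. Qed.
Hint Resolve size_ts_gt0 : core.
Lemma sumn_ts_gt0 : 0 < r.
Proof. by move: ts_head; case: ts => //= x u x0; rewrite addn_gt0 x0. Qed.
Hint Resolve sumn_ts_gt0 : core.

Lemma expn_size_gt1 : 1 < p ^ s. Proof. by rewrite -(expn0 p) ltn_exp2l. Qed.

Let row0 : 'I_r := Ordinal sumn_ts_gt0.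

(** Row 0 is constant and leaves no choice; its level is 0, so omitting it removes the term
    [s - j]. *)
Lemma sum_lev_trunc j : \sum_(k < r | k != 0 :> nat) (s - (lv k + j)) =
  \sum_(i < s) nth 0 ts i * (s - (i + j)) - (s - j).
Proof.
rewrite -(sum_lev (fun l => s - (l + j))) [X in _ = X - _](bigD1 row0) //= lev0 //.
by rewrite add0n addKn; apply: eq_bigl => k; rewrite -val_eqE.
Qed.

(** The conditions on the rows are independent, so the set is a [family] and its size a product. *)
Lemma card_cols_near (c : {ffun 'I_r -> 'I_(p ^ s)}) j :
  #|[set z : {ffun 'I_r -> 'I_(p ^ s)} | [forall k : 'I_r,
     if val k == 0 then val (z k) == 1 else z k == c k %[mod p ^ (lv k + j)]]]| =
  p ^ (\sum_(k < r | k != 0 :> nat) (s - (lv k + j))).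
Proof.
pose F (k : 'I_r) := [pred x : 'I_(p ^ s) | if val k == 0 then val x == 1
  else x == c k %[mod p ^ (lv k + j)]].
transitivity #|family F|.
  by apply: eq_card => z; rewrite inE; apply: eq_forallb => k.
rewrite card_family foldrE big_map big_enum /= expn_sum [RHS]big_mkcond /=.
apply: eq_bigr => k _; case: (eqVneq (k : nat) 0) => hk /=.
  by rewrite -[RHS](card1 (Ordinal expn_size_gt1)); apply: eq_card => x; rewrite [RHS]inE -val_eqE.
rewrite -(card_eqmod (lv k + j) p_gt1 (ltn_ord (c k))) cardsE.
by apply: eq_card.
Qed.

Lemma weight_sum : \sum_(i < s) nth 0 ts i * (s - i) = t.+1.
Proof. by rewrite -ts_weight /weight; apply: eq_bigr => i _; rewrite mulnC. Qed.

Lemma size_le_t : s.-1 <= t.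
Proof.
have := weight_sum; have := size_ts_gt0; have := ts_head.
case: ts => //= x u x0 _; rewrite big_ord_recl /= subn0; nia.
Qed.

Let zero_lt : 0 < p ^ s. Proof. exact: P0. Qed.

Lemma card_colset : #|colset p ts| = p ^ (t - s.-1).
Proof.
rewrite (_ : t - s.-1 = \sum_(k < r | k != 0 :> nat) (s - (lv k + 0))); last first.
  rewrite sum_lev_trunc; under eq_bigr do rewrite addn0.
  by rewrite weight_sum; have := size_ts_gt0; have := size_le_t; lia.
rewrite -(card_cols_near [ffun=> Ordinal zero_lt]); apply: eq_card => z.
rewrite !inE; apply: eq_forallb => k; rewrite ffunE /= addn0 mod0n.
by case: ifP.
Qed.

Lemma ltn_colv (k : 'I_(p ^ t)) : k %/ p ^ s.-1 < #|colset p ts|.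
Proof. by rewrite card_colset ltn_divLR // -expnD subnK // size_le_t. Qed.

Definition colv (k : 'I_(p ^ t)) : {ffun 'I_r -> 'I_(p ^ s)} :=
  nth [ffun=> Ordinal zero_lt] (enum (colset p ts)) (k %/ p ^ s.-1).

(** Rows are indexed by plain naturals, with value 0 out of range, so that indices carry no bound
    proofs. *)
Definition zc (k : 'I_(p ^ t)) (i : nat) : nat :=
  oapp (fun o : 'I_r => val (colv k o)) 0 (insub i).

Definition yc (k : 'I_(p ^ t)) : nat := k %% p ^ s.-1.

Lemma zc_colv k (o : 'I_r) : zc k o = colv k o.
Proof. by rewrite /zc valK. Qed.

Lemma colv_in k : colv k \in colset p ts.
Proof. by rewrite -mem_enum mem_nth // -cardE ltn_colv. Qed.

Lemma yc_lt k : yc k < p ^ s.-1. Proof. by rewrite ltn_mod. Qed.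

Lemma zc_lt k i : zc k i < p ^ s.
Proof. by rewrite /zc; case: insubP => [o _ _|_] //=; apply: ltn_ord. Qed.

Lemma zc0 k : zc k 0 = 1.
Proof.
rewrite (zc_colv k row0); have := colv_in k; rewrite inE => /forallP /(_ row0) /=.
by move/eqP.
Qed.

Lemma zc_dvd k i : i < r -> p ^ lv i %| zc k i.
Proof.
move=> lt_ir; case: i lt_ir => [|i] lt_ir; first by rewrite lev0 // dvd1n.
rewrite (zc_colv k (Ordinal lt_ir)); have := colv_in k; rewrite inE => /forallP.
by move=> /(_ (Ordinal lt_ir)).
Qed.

Lemma point_inj k k' : (forall i, i < r -> zc k i = zc k' i) -> yc k = yc k' -> k = k'.
Proof.
move=> ez ey; have ecolv : colv k = colv k'.
  by apply/ffunP => o; apply: val_inj; rewrite /= -!zc_colv ez.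
apply: val_inj => /=; rewrite (divn_eq k (p ^ s.-1)) (divn_eq k' (p ^ s.-1)).
rewrite -/(yc k) -/(yc k') ey; congr (_ * _ + _).
move/eqP: ecolv; rewrite /colv nth_uniq ?enum_uniq // -?cardE ?ltn_colv //.
by move/eqP.
Qed.

(** With [point_inj], this identifies coordinates with pairs of a column and a position and hides
    the enumeration order. Entries may be given unreduced, because [p ^ lv i] divides [p ^ s]. *)
Lemma point_ex (z : nat -> nat) y : z 0 = 1 ->
  (forall i, i < r -> p ^ lv i %| z i) -> y < p ^ s.-1 ->
  exists k, (forall i, i < r -> zc k i = z i %% p ^ s) /\ yc k = y.
Proof.
move=> z0 zd lty.
have ltz i : z i %% p ^ s < p ^ s by rewrite ltn_mod.
pose c : {ffun 'I_r -> 'I_(p ^ s)} := [ffun i : 'I_r => Ordinal (ltz i)].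
have c_in : c \in enum (colset p ts).
  rewrite mem_enum inE; apply/forallP => k; rewrite ffunE /=.
  case: eqP => [->|_]; first by rewrite z0 modn_small // expn_size_gt1.
  have d : p ^ lv k %| p ^ s by rewrite dvdn_exp2l // ltnW // lev_lt.
  by rewrite /dvdn modn_dvdm //; apply: zd.
have lti : index c (enum (colset p ts)) < p ^ (t - s.-1) by rewrite -card_colset cardE index_mem.
have ltk : index c (enum (colset p ts)) * p ^ s.-1 + y < p ^ t.
  by have := ltn_mulD lti lty; rewrite -expnD subnK // size_le_t.
have kdiv : (index c (enum (colset p ts)) * p ^ s.-1 + y) %/ p ^ s.-1 = index c (enum (colset p ts)).
  by rewrite divnMDl // divn_small // addn0.
exists (Ordinal ltk); split; last by rewrite /yc /= modnMDl modn_small.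
move=> i lt_ir; rewrite (zc_colv _ (Ordinal lt_ir)) /colv /= kdiv nth_index //.
by rewrite ffunE.
Qed.

Definition lincomb (lam : nat -> nat) k := \sum_(i < r) lam i * zc k i.

Lemma natr_gray N y : ((gray p s (N %% p ^ s) y)%:R : 'Z_p)%R = gr p s N y.
Proof.
rewrite /gray Zp_nat_mod // natrD natr_sum /gr digit_mod ?prednK //; congr (_ + _)%R.
apply: eq_bigr => i _; rewrite natrM digit_mod //.
by apply: leq_trans (ltn_ord i) _; rewrite leq_pred.
Qed.

Lemma gr_eqmod N M y : N = M %[mod p ^ s] -> gr p s N y = gr p s M y.
Proof. by move=> e; rewrite -natr_gray e natr_gray. Qed.

(** Only residues of the coefficients modulo [p ^ s] matter; leaving them unbounded spares every
    later reduction. *)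
Lemma GHcodeP (c : {ffun 'I_(p ^ t) -> 'Z_p}) :
  (exists lam : nat -> nat, forall k, c k = gr p s (lincomb lam k) (yc k)) <-> c \in GHcode p t ts.
Proof.
have nthE (k : 'I_(p ^ t)) (i : 'I_r) : nth (fun _ => 0)
    [seq (fun k0 : 'I_r => val (z k0)) | z : {ffun 'I_r -> 'I_(p ^ s)} <- enum (colset p ts)]
    (k %/ p ^ s.-1) i = zc k i.
  by rewrite (nth_map [ffun=> Ordinal zero_lt]) -?cardE ?ltn_colv // zc_colv.
split=> [[lam ec]|/imsetP[lam _ ->]].
  have ltl i : lam i %% p ^ s < p ^ s by rewrite ltn_mod.
  apply/imsetP; exists [ffun i : 'I_r => Ordinal (ltl i)] => //.
  apply/ffunP => k; rewrite ec ffunE natr_gray; apply: gr_eqmod.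
  rewrite /lincomb -[LHS]modn_summ -[RHS]modn_summ; congr (_ %% _); apply: eq_bigr => i _.
  by rewrite nthE ffunE /= modnMml.
exists (fun i => oapp (fun o : 'I_r => val (lam o)) 0 (insub i)) => k.
rewrite ffunE natr_gray; congr gr; apply: eq_bigr => i _.
by rewrite nthE valK.
Qed.

End Coordinates.

(** * Digit replacement, progressions and the top digit *)

Section DigitsAndGray.
Variable p : nat.
Hypothesis p_gt1 : 1 < p.
Let P0 := expnp_gt0 p_gt1.

Lemma digit_divX N a b : digit p (N %/ p ^ a) b = digit p N (a + b).
Proof. by rewrite /digit -divnMA expnD. Qed.

Lemma digit_bump a i k : a < p ^ i -> digit p (a + p ^ i) k = (k == i) + digit p a k.
Proof.
move=> lta; have -> : a + p ^ i = a + p ^ i * 1 by rewrite muln1.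
case: (ltngtP k i) => [lt|gt|->].
- by rewrite digit_addM_lt.
- rewrite (digit_small p_gt1 lta (ltnW gt)) (@digit_small _ p_gt1 _ i.+1) //.
  by rewrite expnS; move: (p ^ i) lta => b lta; nia.
- by rewrite digit_addM // (digit_small p_gt1 lta) // modn_small.
Qed.

Lemma digit_replace N s i h k : i < s -> h < p -> k < s ->
  digit p (N + (p ^ s - digit p N i * p ^ i) + h * p ^ i) k =
  if k == i then h else digit p N k.
Proof.
move=> lis lth lks; set D := digit p N i.
have e : N = N %% p ^ i + D * p ^ i + p ^ i.+1 * (N %/ p ^ i.+1).
  by rewrite addnC mulnC [_ %% _ + _]addnC -modn_expnS // -divn_eq.
have leD : D * p ^ i <= p ^ s.
  have := ltn_digit p_gt1 N i; rewrite -/D => ltD.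
  apply: leq_trans (_ : p * p ^ i <= _); first by rewrite leq_mul2r (ltnW ltD) orbT.
  by rewrite -expnS leq_exp2l.
have {1}-> : N + (p ^ s - D * p ^ i) + h * p ^ i =
    (N %% p ^ i + p ^ i * h) + p ^ i.+1 * (N %/ p ^ i.+1 + p ^ (s - i.+1) * 1).
  rewrite mulnDr muln1 -expnD subnKC // {1}e; move: leD.
  move: (p ^ s) (D * p ^ i) (p ^ i.+1 * _) (N %% p ^ i) => a b c d.
  by rewrite [p ^ i * h]mulnC; move: (h * p ^ i) => f; lia.
have lt : N %% p ^ i + p ^ i * h < p ^ i.+1.
  by rewrite expnS addnC [p ^ i * h]mulnC; apply: ltn_mulD; rewrite ?ltn_mod.
case: (ltngtP k i) => [lki|lik|->].
- rewrite digit_addM_lt // 1?ltnW // digit_addM_lt //.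
  by rewrite digit_mod.
- rewrite -{1}(subnKC lik) -digit_divX addnC mulnC divnMDl // (divn_small lt) addn0.
  by rewrite digit_addM_lt ?digit_divX ?subnKC // ltn_sub2r //; lia.
- by rewrite digit_addM_lt // digit_addM // (@digit_small _ p_gt1 _ i) ?ltn_mod // add0n modn_small.
Qed.

(** The common remainder modulo [p ^ e] cancels, so the quotients still form a progression. *)
Lemma eqmod_div_ap (N : nat -> nat) s e : e.+1 < s ->
  N 0 + N 2 = 2 * N 1 %[mod p ^ s] ->
  (forall i, i < 3 -> N i = N 0 %[mod p ^ e]) ->
  N 0 %/ p ^ e + N 2 %/ p ^ e = 2 * (N 1 %/ p ^ e) %[mod p ^ 2].
Proof.
move=> lt ap cst; have {}ap := eqmod_expn_le lt ap.
move: ap; rewrite {1}(divn_eq (N 0) (p ^ e)) {1}(divn_eq (N 2) (p ^ e)) {1}(divn_eq (N 1) (p ^ e)).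
rewrite (cst 1) // (cst 2) //; move: (N 0 %% p ^ e) => a.
move: (N 0 %/ _) (N 2 %/ _) (N 1 %/ _) => u v w.
have -> : u * p ^ e + a + (v * p ^ e + a) = (u + v) * p ^ e + 2 * a by lia.
have -> : 2 * (w * p ^ e + a) = (2 * w) * p ^ e + 2 * a by lia.
move/eqP; rewrite eqn_modDr (_ : e.+2 = 2 + e) // expnD -!muln_modl.
by rewrite eqn_pmul2r // => /eqP.
Qed.

Lemma eqmod_mull_dvd lam a b m M : a = b %[mod m] -> M %| lam * m ->
  lam * a = lam * b %[mod M].
Proof.
move=> e d; rewrite -(modn_dvdm (lam * a) d) -(modn_dvdm (lam * b) d).
by rewrite -!muln_modr e.
Qed.

(** The bound [1 < n] lets [n - 2], [n - 1] and [n] number three points of a progression. *)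
Lemma solve_affine D T a : coprime a p -> exists2 n, 1 < n & D + n * a = T %[mod p].
Proof.
move=> co; have [u e] : exists u, u * a = 1 %[mod p].
  have [|u v e _] := egcdnP p (m := a); first by case: (a) co => // ; rewrite /coprime gcd0n => /eqP; lia.
  by exists u; rewrite e (eqP co) modnMDl.
(* As [u] inverts [a] and [p - 1] stands for minus one, this is [T - D] divided by [a]; the summand
   [2 * p] secures [1 < n]. *)
exists (u * (T + (p - 1) * D) + 2 * p); first by apply: leq_trans (leq_addl _ _); lia.
have -> X : D + (u * X + 2 * p) * a = (2 * a) * p + (D + X * (u * a)) by lia.
rewrite modnMDl -modnDmr -modnMmr e modnMmr modnDmr muln1.
have -> : D + (T + (p - 1) * D) = D * p + T by move: p_gt1; nia.
by rewrite modnMDl.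
Qed.

Lemma natr_Zp_inj a b : (a%:R = b%:R :> 'Z_p)%R -> a = b %[mod p].
Proof. by move=> /(congr1 (@nat_of_ord _)); rewrite !val_Zp_nat. Qed.

Lemma eqmod_natr_Zp a b : a = b %[mod p] -> (a%:R = b%:R :> 'Z_p)%R.
Proof. by move=> e; rewrite -Zp_nat_mod // e Zp_nat_mod. Qed.

(** The top digit enters the Gray map with coefficient 1 at every position. *)
Lemma gr_addtop s N q y : gr p s (N + p ^ s.-1 * q) y = (gr p s N y + q%:R)%R.
Proof.
rewrite /gr digit_addM // Zp_nat_mod // natrD addrAC; congr (_ + _ + _)%R.
by apply: eq_bigr => i _; rewrite digit_addM_lt.
Qed.

Lemma gr0 s y : gr p s 0 y = 0%R.
Proof.
rewrite /gr /digit !div0n !mod0n add0r big1 // => i _.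
by rewrite div0n mod0n mul0r.
Qed.

End DigitsAndGray.

(** * Iterated kernel refinement *)

Section Refinement.
Variables (p N : nat).
Implicit Types (C : {set {ffun 'I_N -> 'Z_p}}) (R : rel 'I_N).

(* [x] is in the kernel of the restriction of [C] to the [R]-class of [d]. *)
Definition inker C R d (x : {ffun 'I_N -> 'Z_p}) :=
  [forall c in C, exists c' in C, forall e, R d e ==> (c' e == c e + x e)%R].

Definition refine C R : rel 'I_N := fun d d' =>
  R d d' && [forall x, inker C R d x ==> (x d == x d')].

Definition refine_iter C j : rel 'I_N := iter j (refine C) (fun _ _ => true).

Lemma eq_refine C R R' : R =2 R' -> refine C R =2 refine C R'.
Proof.
move=> eR d d'; rewrite /refine eR; congr (_ && _); apply: eq_forallb => x.
congr (_ ==> _); apply: eq_forallb => c; congr (_ ==> _); apply: eq_existsb => c'.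
by congr (_ && _); apply: eq_forallb => e; rewrite eR.
Qed.

(** The translation [a] cancels in the kernel condition, and [pi] carries the kernel words of one
    code to those of the other. *)
Lemma refine_trans_perm C R R' (a : {ffun 'I_N -> 'Z_p}) (pi : {perm 'I_N}) :
  (forall d d', R' d d' = R (pi d) (pi d')) ->
  forall d d', refine [set a + [ffun k => c (pi k)] | c : {ffun 'I_N -> 'Z_p} in C]%R R' d d'
    = refine C R (pi d) (pi d').
Proof.
move=> eR d d'; rewrite /refine eR; congr (_ && _).
set C' := imset _ _.
have ker (x : {ffun 'I_N -> 'Z_p}) : inker C' R' d [ffun k => x (pi k)] = inker C R (pi d) x.
  apply/forall_inP/forall_inP => h c cC.
    have /h/exists_inP[c2 /imsetP[c1 c1C ->] /forallP h1] : (a + [ffun k => c (pi k)])%R \in C'.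
      exact: imset_f.
    apply/exists_inP; exists c1 => //; apply/forallP => e.
    have := h1 ((pi^-1)%g e); rewrite eR !ffunE permKV -addrA.
    by case: (R _ _) => //=; rewrite (inj_eq (addrI _)).
  have /imsetP[c1 /h/exists_inP[c2 c2C /forallP h1] ->] := cC.
  apply/exists_inP; exists (a + [ffun k => c2 (pi k)])%R; first exact: imset_f.
  apply/forallP => e; have := h1 (pi e); rewrite eR !ffunE -addrA.
  by case: (R _ _) => //=; rewrite (inj_eq (addrI _)).
apply/forall_inP/forall_inP => h x.
  by rewrite -ker => /h; rewrite !ffunE.
have -> : x = [ffun k => [ffun i => x ((pi^-1)%g i)] (pi k)].
  by apply/ffunP => k; rewrite !ffunE permK.
by rewrite ker => /h; rewrite !ffunE.
Qed.

Lemma card_refine_iter_equiv C C' j : code_equiv C C' ->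
  exists pi : {perm 'I_N}, forall d,
    #|[set e | refine_iter C' j d e]| = #|[set e | refine_iter C j (pi d) e]|.
Proof.
case/existsP => a /existsP[pi /eqP ->]; exists pi => d.
have e : forall d d', refine_iter
    [set a + [ffun k => c (pi k)] | c : {ffun 'I_N -> 'Z_p} in C]%R j d d'
    = refine_iter C j (pi d) (pi d').
  by elim: j => //= j IH; apply: refine_trans_perm.
rewrite -[RHS](card_preimset _ (@perm_inj _ pi)); apply: eq_card => k.
by rewrite !inE e.
Qed.

End Refinement.

(** * Congruence classes of coordinates and the words separating them *)

Section Kernel.
Variables (p t : nat) (ts : seq nat).
Hypothesis p_gt1 : 1 < p.
Hypothesis ts_head : 0 < nth 0 ts 0.
Hypothesis ts_weight : weight ts = t.+1.

Notation s := (size ts).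
Notation r := (sumn ts).
Notation lv := (lev ts).
Notation zc := (@zc p t ts p_gt1).
Notation yc := (@yc p t ts).
Notation NN := (@lincomb p t ts p_gt1).
Notation code := (GHcode p t ts).
Implicit Types (d e k : 'I_(p ^ t)).
Let P0 := expnp_gt0 p_gt1.

Let s_gt0 : 0 < s. Proof. exact: size_ts_gt0. Qed.

(** Because [j.-1] truncates, neither [near 0] nor [near 1] restricts [yc]. *)
Definition near j : rel 'I_(p ^ t) := fun d e =>
  [forall i : 'I_r, zc d i == zc e i %[mod p ^ (lv i + j)]] && (yc d == yc e %[mod p ^ j.-1]).

Lemma nearP j d e : reflect ((forall i, i < r -> zc d i = zc e i %[mod p ^ (lv i + j)]) /\
  yc d = yc e %[mod p ^ j.-1]) (near j d e).
Proof.
apply: (iffP andP) => [[/forallP h /eqP hy]|[h hy]]; split=> //; last exact/eqP.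
  by move=> i lt; apply/eqP/(h (Ordinal lt)).
by apply/forallP => i; apply/eqP/h.
Qed.

Lemma near_refl j d : near j d d. Proof. exact/nearP. Qed.

Lemma near_eq j d e : s <= j -> near j d e -> d = e.
Proof.
move=> le_sj /nearP[hz hy]; apply: (@point_inj p t ts p_gt1 ts_head ts_weight) => [i lt|].
  have /eqmod_expn_le := hz _ lt => /(_ s (leq_trans le_sj (leq_addl _ _))).
  by rewrite !modn_small // zc_lt.
have le : s.-1 <= j.-1 by lia.
by have := eqmod_expn_le le hy; rewrite !modn_small // yc_lt.
Qed.

Lemma near0 d e : near 0 d e.
Proof.
apply/nearP; split=> [i lt|]; last by rewrite !modn1.
have h k := zc_dvd p_gt1 ts_head ts_weight k lt.
by rewrite addn0 (eqP (h d)) (eqP (h e)).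
Qed.

(** The positions contribute [p ^ (s - j)], exactly the factor missing from the constant row 0, so
    the sum runs over all rows. At [j = 0] they would give only [p ^ s.-1]. *)
Lemma card_near j d : 0 < j ->
  #|[set e | near j d e]| = p ^ (\sum_(i < s) nth 0 ts i * (s - (i + j))).
Proof.
move=> j0.
pose f e := (colv ts p_gt1 e, Ordinal (yc_lt ts p_gt1 e : yc e < p ^ s.-1)).
have f_inj : injective f.
  move=> k k' [e1 e2]; apply: (@point_inj p t ts p_gt1 ts_head ts_weight) => // i _.
  by rewrite /zc e1.
rewrite -(card_imset _ f_inj).
set A := [set z : {ffun 'I_r -> 'I_(p ^ s)} | [forall k : 'I_r,
     if val k == 0 then val (z k) == 1 else z k == colv ts p_gt1 d k %[mod p ^ (lv k + j)]]].
set B := [set y : 'I_(p ^ s.-1) | y == yc d %[mod p ^ j.-1]].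
have -> : f @: [set e | near j d e] = setX A B.
  apply/setP => -[z y]; rewrite inE /=; apply/imsetP/andP => [[e]|[]].
    rewrite inE => /nearP[hz hy] [-> ->]; rewrite !inE; split; last by rewrite /= eq_sym; apply/eqP.
    apply/forallP => k; case: eqP => hk; first by rewrite /= -zc_colv hk zc0.
    by rewrite eq_sym -!zc_colv; apply/eqP/hz.
  rewrite !inE => /forallP hz /eqP hy.
  have r0 := sumn_ts_gt0 ts_head.
  have [|i lti||e [ez ey]] := @point_ex p t ts p_gt1 ts_head ts_weight
    (fun i => oapp (fun o : 'I_r => val (z o)) 0 (insub i)) y.
  - by rewrite (insubT (fun x => x < r) r0) /=; have /= /eqP := hz (Ordinal r0).
  - rewrite (insubT (fun x => x < r) lti) /=; have /= := hz (Ordinal lti).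
    case: i lti => [|i] lti; first by rewrite lev0 // dvd1n.
    move=> /eqP/(eqmod_expn_le (leq_addr j _)) e0.
    by rewrite /dvdn e0 -(zc_colv p_gt1 _ (Ordinal lti)) -/(dvdn _ _) zc_dvd.
  - exact: ltn_ord.
  have ez' (i : 'I_r) : zc e i = z i by rewrite ez // valK /= modn_small.
  exists e; last first.
    congr (_, _); last exact: val_inj.
    by apply/ffunP => i; apply: val_inj; rewrite /= -zc_colv ez'.
  rewrite inE; apply/nearP; split; last by rewrite ey hy.
  move=> i lti; have := hz (Ordinal lti); rewrite (ez' (Ordinal lti)) /=.
  case: eqP => [hi /eqP->|_ /eqP ->]; first by rewrite hi zc0.
  by rewrite -(zc_colv p_gt1 d (Ordinal lti)).
rewrite cardsX (card_cols_near p_gt1 ts_head) (card_eqmod _ p_gt1 (yc_lt ts p_gt1 d)) -expnD.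
rewrite (sum_lev_trunc ts_head) (_ : s.-1 - j.-1 = s - j); last by lia.
rewrite subnK //; move: ts_head s_gt0; case: (ts) => // x u /= x0 _.
rewrite big_ord_recl /= add0n; apply: leq_trans (leq_addr _ _).
by rewrite leq_pmull.
Qed.

Definition single i a : nat -> nat := fun n => (n == i) * a.

Lemma NN_add lam mu k : NN (fun i => lam i + mu i) k = NN lam k + NN mu k.
Proof. by rewrite /lincomb -big_split; apply: eq_bigr => i _; rewrite mulnDl. Qed.

Lemma NN_single i a k : i < r -> NN (single i a) k = a * zc k i.
Proof.
move=> lt; rewrite /lincomb (bigD1 (Ordinal lt)) //= /single eqxx mul1n big1 ?addn0 // => j.
by rewrite -val_eqE /= => /negbTE ->; rewrite !mul0n.
Qed.

Lemma NN_single0 a k : NN (single 0 a) k = a.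
Proof. by rewrite NN_single ?(sumn_ts_gt0 ts_head) // zc0 // muln1. Qed.

Lemma eq_NN lam k k' : (forall i, i < r -> zc k i = zc k' i) -> NN lam k = NN lam k'.
Proof. by move=> e; apply: eq_bigr => i _; rewrite e. Qed.

Lemma NN_near lam j d e : near j d e -> NN lam d = NN lam e %[mod p ^ j].
Proof.
case/nearP=> h _; rewrite /lincomb -[LHS]modn_summ -[RHS]modn_summ; congr (_ %% _).
apply: eq_bigr => i _; rewrite -modnMmr -[RHS]modnMmr; congr ((_ * _) %% _).
by apply: eqmod_expn_le (h i (ltn_ord i)); rewrite leq_addl.
Qed.

(** Two kinds of kernel words do the separating: a digit of the position, and a quotient of an entry
    of the column. *)
Lemma refine_nearW j d d' : j < s -> refine code (near j) d d' -> near j.+1 d d'.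
Proof.
move=> ltjs /andP[nr /forallP ker]; have /nearP[hz hy] := nr.
have codeE := GHcodeP p_gt1 ts_head ts_weight.
apply/nearP; split; last first.
  case: j ltjs nr ker hy {hz} => [|j] ltjs nr ker hy /=; first by rewrite !modn1.
  apply: eqmod_expnS => //=.
  rewrite -(modn_small (ltn_digit p_gt1 (yc d) j)) -(modn_small (ltn_digit p_gt1 (yc d') j)).
  apply: natr_Zp_inj => //.
  (* Digit [j] of [u] has a constant value [h] on the class; replacing it by [h + 1] modulo [p],
     through a multiple of the all-one row, adds digit [j] of [yc] to the word. *)
  have /implyP := ker [ffun e => (digit p (yc e) j)%:R]%R; rewrite !ffunE => kx; apply/eqP/kx.
  apply/forall_inP => c /codeE[lam ec]; apply/exists_inP.
  set h := digit p (NN lam d) j; pose h' := (h + 1) %% p.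
  pose mu i := lam i + single 0 (p ^ s - h * p ^ j + h' * p ^ j) i.
  exists [ffun e => gr p s (NN mu e) (yc e)].
    by apply/codeE; exists mu => e; rewrite ffunE.
  apply/forallP => e; apply/implyP => nre; rewrite !ffunE ec NN_add NN_single0 addnA.
  have eh : h = digit p (NN lam e) j by apply: digit_eqmod (NN_near lam nre) _.
  have ltj : j < s.-1 by lia.
  rewrite /gr eh !digit_replace ?ltn_mod ?prednK ?(ltnW p_gt1) //; try lia.
  rewrite (_ : (s.-1 == j) = false); last by lia.
  apply/eqP; rewrite -!addrA; congr (_ + _)%R.
  rewrite (bigD1 (Ordinal ltj)) //= [in RHS](bigD1 (Ordinal ltj)) //= digit_replace ?ltn_mod ?(ltnW p_gt1) //; try lia.
  rewrite eqxx Zp_nat_mod // natrD mulrDl mul1r -eh -!addrA; congr (_ + _)%R.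
  rewrite addrC; congr (_ + _)%R; apply: eq_bigr => i; rewrite -val_eqE /= => nei.
  rewrite eh digit_replace ?ltn_mod ?(ltnW p_gt1) // ?(negbTE nei) //; try lia.
  by have := ltn_ord i; lia.
move=> i lti; rewrite addnS; case: (leqP s (lv i + j)) => [ge|lt].
  have /(eqmod_expn_le ge) := hz _ lti.
  by rewrite !(modn_small (zc_lt _ _ _ _)) => ->.
apply: eqmod_expnS; rewrite ?hz //; apply: natr_Zp_inj => //.
set m := lv i + j.
have /implyP := ker [ffun e => (zc e i %/ p ^ m)%:R]%R; rewrite !ffunE => kx.
apply/eqP/kx.
apply/forall_inP => c /codeE[lam ec]; apply/exists_inP.
set z := zc d i %% p ^ m.
(* Scaled by [p ^ (s.-1 - m)], row [i] puts [zc e i %/ p ^ m] on the top digit; the multiple of row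
   0 cancels the remainder [z], common to the whole class. *)
pose mu n := lam n + (single 0 ((p ^ s - p ^ (s.-1 - m)) * z) n + single i (p ^ (s.-1 - m)) n).
exists [ffun e => gr p s (NN mu e) (yc e)].
  by apply/codeE; exists mu => e; rewrite ffunE.
apply/forallP => e; apply/implyP => /nearP[nre _]; rewrite !ffunE ec.
rewrite NN_add NN_add NN_single0 NN_single // -gr_addtop //; apply/eqP/gr_eqmod => //.
rewrite (divn_eq (zc e i) (p ^ m)) -(nre i lti) -/m -/z mulnDr.
rewrite [p ^ (s.-1 - m) * (_ * _)]mulnCA -expnD subnK; last by lia.
have le : p ^ (s.-1 - m) <= p ^ s by rewrite leq_exp2l //; lia.
rewrite divnMDl // (divn_small (ltn_pmod _ _)) // addn0.
rewrite mulnBl; have le' : p ^ (s.-1 - m) * z <= p ^ s * z by rewrite leq_mul2r le orbT.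
rewrite [_ * p ^ s.-1]mulnC.
move: (p ^ (s.-1 - m) * z) le' (p ^ s.-1 * _) (NN lam e) => a le' b n.
have -> : n + (p ^ s * z - a + (b + a)) = z * p ^ s + (n + b) by lia.
by rewrite modnMDl.
Qed.

End Kernel.

(** * Carries along lines of columns *)

Section KernelUpper.
Variables (p t : nat) (ts : seq nat).
Hypothesis p_gt1 : 1 < p.
Hypothesis ts_head : 0 < nth 0 ts 0.
Hypothesis ts_weight : weight ts = t.+1.

Notation s := (size ts).
Notation r := (sumn ts).
Notation lv := (lev ts).
Notation zc := (@zc p t ts p_gt1).
Notation yc := (@yc p t ts).
Notation NN := (@lincomb p t ts p_gt1).
Notation code := (GHcode p t ts).
Notation near := (@near p t ts p_gt1).
Implicit Types (d e : 'I_(p ^ t)).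
Let P0 := expnp_gt0 p_gt1.
Let s_gt0 : 0 < s. Proof. exact: size_ts_gt0. Qed.

(** Moves [n] steps along row [i]; steps of [p ^ (lv i + j)] keep the point inside the class of
    [d]. *)
Lemma near_line j d i n : 0 < i < r -> exists e, near j d e /\
  forall lam, NN lam e = NN lam d + n * (lam i * p ^ (lv i + j)) %[mod p ^ s].
Proof.
case/andP=> i0 ltir.
pose z k := zc d k + (k == i) * (n * p ^ (lv i + j)).
have [||e [ez ey]] := @point_ex p t ts p_gt1 ts_head ts_weight z (yc d) _ _ (yc_lt ts p_gt1 d).
- by rewrite /z zc0 // eq_sym (gtn_eqF i0) mul0n addn0.
- move=> k ltk; rewrite /z dvdn_add ?zc_dvd //; case: eqP => [->|_] /=; last by rewrite mul0n dvdn0.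
  by rewrite mul1n dvdn_mull // dvdn_exp2l // leq_addr.
exists e; split.
  apply/nearP; split; last by rewrite ey.
  move=> k ltk; rewrite ez // /z; case: (eqVneq k i) => [->|_] /=; last first.
    by rewrite mul0n addn0 [in RHS](modn_small (zc_lt _ _ _ _)).
  rewrite mul1n; case: (leqP (lv i + j) s) => [le|/ltnW gt].
    by rewrite (modn_dvdm _ (dvdn_exp2l _ le)) [zc d i + _]addnC modnMDl.
  have /eqP dv : p ^ s %| n * p ^ (lv i + j) by rewrite dvdn_mull // dvdn_exp2l.
  by rewrite -[in RHS](modnDmr (zc d i)) dv addn0 [in RHS](modn_small (zc_lt _ _ _ _)).
move=> lam; have -> : NN lam d + n * (lam i * p ^ (lv i + j)) = \sum_(k < r) lam k * z k.
  rewrite (bigD1 (Ordinal ltir)) //= /lincomb (bigD1 (Ordinal ltir)) //= /z eqxx.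
  rewrite mul1n mulnDr -!addnA; congr (_ + _); rewrite addnC mulnCA; congr (_ + _).
  apply: eq_bigr => k; rewrite -val_eqE /= => /negbTE ->.
  by rewrite mul0n addn0.
rewrite /lincomb -[LHS]modn_summ -[RHS]modn_summ; congr (_ %% _).
by apply: eq_bigr => k _; rewrite ez // modnMmr.
Qed.

Section Class.
Variables (j : nat) (d : 'I_(p ^ t)).
Let ya := yc d %% p ^ j.-1.

(** Column and position vary independently in a class, so words can be compared at several positions
    over one column. *)
Lemma near_change_y e y : near j d e -> y = yc d %[mod p ^ j.-1] -> y < p ^ s.-1 ->
  exists e', [/\ near j d e', yc e' = y & forall lam, NN lam e' = NN lam e].
Proof.
case/nearP=> hz hy ey lty.
have [||e' [ez' ey']] := @point_ex p t ts p_gt1 ts_head ts_weight (zc e) y _ _ lty.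
- by rewrite zc0.
- by move=> k ltk; apply: zc_dvd.
have ez k : k < r -> zc e' k = zc e k by move=> ltk; rewrite ez' // (modn_small (zc_lt _ _ _ _)).
exists e'; split=> // [|lam]; last exact: eq_NN.
by apply/nearP; split=> [k ltk|]; rewrite ?ez ?hz // ey' ey.
Qed.

(** The digits of [ya] from [j] on vanish and those of [NN lam] below [j] are constant on the class,
    so only the top digit can vary. *)
Lemma gr_low lam e : near j d e ->
  gr p s (NN lam e) ya = ((digit p (NN lam e) s.-1)%:R +
   \sum_(i < s.-1) (digit p (NN lam d) i)%:R * (digit p ya i)%:R)%R.
Proof.
move=> nr; congr (_ + _)%R; apply: eq_bigr => i _.
case: (ltnP i j) => [lt|ge]; first by rewrite (digit_eqmod p_gt1 (NN_near lam nr) lt).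
rewrite (@digit_small _ p_gt1 ya j.-1) ?ltn_mod // ?mulr0 //.
by apply: leq_trans ge; apply: leq_pred.
Qed.

Lemma gr_bump N i : j <= i < s.-1 ->
  gr p s N (ya + p ^ i) = (gr p s N ya + (digit p N i)%:R)%R.
Proof.
case/andP=> leji lti; rewrite /gr -addrA; congr (_ + _)%R.
have lty : ya < p ^ i.
  by apply: leq_trans (_ : p ^ j.-1 <= _); rewrite ?ltn_mod ?leq_exp2l // (leq_trans (leq_pred _)).
rewrite (bigD1 (Ordinal lti)) //= [in RHS](bigD1 (Ordinal lti)) //=.
rewrite digit_bump // eqxx natrD mulrDr mulr1 addrC -[RHS]addrA [RHS]addrCA; congr (_ + _)%R; last by rewrite addrC.
apply: eq_bigr => k; rewrite -val_eqE /= => /negbTE nk.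
by rewrite digit_bump // nk.
Qed.

Variables lam tau mu : nat -> nat.
Hypothesis sumE : forall e, near j d e ->
  (gr p s (NN lam e) (yc e) + gr p s (NN tau e) (yc e) = gr p s (NN mu e) (yc e))%R.

(** Comparing [sumE] at [ya + p ^ i] and at [ya] over the same column isolates digit [i]. *)
Lemma digit_sum e i : near j d e -> j <= i < s.-1 ->
  digit p (NN mu e) i = digit p (NN lam e) i + digit p (NN tau e) i %[mod p].
Proof.
move=> nr rng; have /andP[leji lti] := rng; apply: natr_Zp_inj => //.
have ltya : ya < p ^ i.
  by apply: leq_trans (_ : p ^ j.-1 <= _); rewrite ?ltn_mod ?leq_exp2l // (leq_trans (leq_pred _)).
have lt1 : ya + p ^ i < p ^ s.-1.
  apply: leq_trans (_ : p ^ i.+1 <= _); last by rewrite leq_exp2l.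
  by rewrite expnS; move: (ya) (p ^ i) ltya => a b lta; nia.
have lt0 : ya < p ^ s.-1 by apply: leq_ltn_trans lt1; apply: leq_addr.
have m1 : ya + p ^ i = yc d %[mod p ^ j.-1].
  have /eqP e0 : p ^ j.-1 %| p ^ i by rewrite dvdn_exp2l // (leq_trans (leq_pred _)).
  by rewrite -modnDmr e0 addn0 modn_mod.
have [e1 [n1 y1 N1]] := near_change_y nr m1 lt1.
have [e0 [n0 y0 N0]] := near_change_y nr (modn_mod _ _) lt0.
have := sumE n1; rewrite y1 !N1 !gr_bump //.
have := sumE n0; rewrite y0 !N0 => <-.
by rewrite addrACA natrD => /addrI ->.
Qed.

(** The top digit is multiplied by no digit of the position, so it cannot be isolated; at [ya] all
    other terms are constant on the class, and [kap] is their discrepancy. *)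
Lemma digit_sum_top : exists kap, forall e, near j d e ->
  digit p (NN mu e) s.-1 = digit p (NN lam e) s.-1 + digit p (NN tau e) s.-1 + kap %[mod p].
Proof.
pose K l := (\sum_(i < s.-1) (digit p (NN l d) i)%:R * (digit p ya i)%:R : 'Z_p)%R.
exists (nat_of_ord (K lam + K tau - K mu)%R) => e nr; apply: natr_Zp_inj => //.
have lt0 : ya < p ^ s.-1.
  by apply: leq_ltn_trans (yc_lt ts p_gt1 d); apply: leq_mod.
have [e0 [n0 y0 N0]] := near_change_y nr (modn_mod _ _) lt0.
have := sumE n0; rewrite y0 !gr_low // !N0 -/(K lam) -/(K tau) -/(K mu) => h.
by rewrite !natrD natr_Zp -[LHS](addrK (K mu)) -h addrACA -!addrA.
Qed.

(** Cutting off the constant digits below [f] leaves progressions modulo [p ^ 2], to which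
    [three_term_carry] applies. *)
Lemma carry_line (E : nat -> 'I_(p ^ t)) f : 2 < p -> j <= f < s.-1 ->
  (forall i, i < 3 -> near j d (E i)) ->
  (forall l, NN l (E 0) + NN l (E 2) = 2 * NN l (E 1) %[mod p ^ s]) ->
  (forall i, i < 3 -> NN lam (E i) = NN lam (E 0) %[mod p ^ f]) ->
  (forall i, i < 3 -> NN tau (E i) = NN tau (E 0) %[mod p ^ f]) ->
  (p <= digit p (NN lam (E 1)) f + digit p (NN tau (E 1)) f) =
  (p <= digit p (NN lam (E 2)) f + digit p (NN tau (E 2)) f).
Proof.
move=> p_gt2 /andP[lejf ltf] nr ap cl ct.
(* Digits of [mu] below [j] are constant on the class; the others below [f] are sums of constant
   digits modulo [p]. *)
have cm i : i < 3 -> NN mu (E i) = NN mu (E 0) %[mod p ^ f].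
  move=> i3; apply: eqmod_digits => // k ltk; case: (ltnP k j) => [ltkj|lejk].
    rewrite -(digit_eqmod p_gt1 (NN_near mu (nr _ i3)) ltkj).
    by rewrite -(digit_eqmod p_gt1 (NN_near mu (nr 0 _)) ltkj).
  have rng : j <= k < s.-1 by rewrite lejk (ltn_trans ltk).
  rewrite -(modn_small (ltn_digit p_gt1 (NN mu (E i)) k)) -(modn_small (ltn_digit p_gt1 (NN mu (E 0)) k)).
  rewrite !digit_sum ?nr // (digit_eqmod p_gt1 (cl _ i3) ltk).
  by rewrite (digit_eqmod p_gt1 (ct _ i3) ltk).
have f2 : f.+1 < s by lia.
(* A nonzero shift can arise only when [f.+1] is the top digit. *)
have [kap hk] : exists kap, forall i, i < 3 -> digit p (NN mu (E i)) f.+1 =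
    digit p (NN lam (E i)) f.+1 + digit p (NN tau (E i)) f.+1 + kap %[mod p].
  case: (ltnP f.+1 s.-1) => [lt|ge].
    by exists 0 => i i3; rewrite addn0 digit_sum ?nr //; rewrite lt andbT ltnW.
  have -> : f.+1 = s.-1 by lia.
  by have [kap hk] := digit_sum_top; exists kap => i i3; rewrite hk ?nr.
apply: (@three_term_carry _ p_gt1 (fun i => NN lam (E i) %/ p ^ f) (fun i => NN tau (E i) %/ p ^ f)
  (fun i => NN mu (E i) %/ p ^ f) kap) => //.
- exact: (eqmod_div_ap p_gt1 (N := fun i => NN lam (E i)) f2 (ap lam) cl).
- exact: (eqmod_div_ap p_gt1 (N := fun i => NN tau (E i)) f2 (ap tau) ct).
- exact: (eqmod_div_ap p_gt1 (N := fun i => NN mu (E i)) f2 (ap mu) cm).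
- move=> i i3; have := @digit_sum (E i) f (nr _ i3); rewrite lejf ltf => /(_ isT).
  by rewrite /digit modn_mod modnDm.
- by move=> i i3; rewrite !digit_divX addn1 hk.
Qed.

End Class.

Hypothesis p_prime : prime p.
Hypothesis p_gt2 : 2 < p.

Section KernelWord.
Variables (j : nat) (d : 'I_(p ^ t)) (lam : nat -> nat).
Hypothesis stable : forall tau, exists mu, forall e, near j d e ->
  (gr p s (NN lam e) (yc e) + gr p s (NN tau e) (yc e) = gr p s (NN mu e) (yc e))%R.

Lemma near_ap i n : 0 < i < r -> 1 < n -> exists E : nat -> 'I_(p ^ t),
 [/\ forall m, m < 3 -> near j d (E m),
     forall l, NN l (E 0) + NN l (E 2) = 2 * NN l (E 1) %[mod p ^ s] &
     forall l m, m < 3 -> NN l (E m) = NN l d + (n - 2 + m) * (l i * p ^ (lv i + j)) %[mod p ^ s]].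
Proof.
move=> rng n1.
have [e0 [r0 N0]] := near_line j d (n - 2 + 0) rng.
have [e1 [r1 N1]] := near_line j d (n - 2 + 1) rng.
have [e2 [r2 N2]] := near_line j d (n - 2 + 2) rng.
exists (fun m => if m == 0 then e0 else if m == 1 then e1 else e2); split=> /=.
- by move=> [|[|[|]]].
- move=> l; rewrite -modnDm N0 N2 modnDm -modnMmr N1 modnMmr; congr (_ %% _).
  by move: (NN l d) (l i * _) (n - 2) => a b c; lia.
- by move=> l [|[|[|]]].
Qed.

(** Otherwise a digit of [NN lam] below the top changes along row [i], and adding a constant word
    carries at some points of the line but not at others. *)
Lemma kernel_slope i : 0 < i < r -> p ^ s.-1 %| lam i * p ^ (lv i + j).
Proof.
move=> rng; apply: contraT => ndv; set a := lam i * _ in ndv.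
have a0 : 0 < a by rewrite lt0n; apply: contraNneq ndv => ->; rewrite dvdn0.
set f := logn p a; have ltf : f < s.-1 by move: ndv; rewrite pfactor_dvdn // -ltnNge.
have lejf : j <= f.
  by rewrite -pfactor_dvdn // dvdn_mull // dvdn_exp2l // leq_addl.
have [a' co ea] := pfactor_coprime p_prime a0; rewrite -/f in ea.
(* At the last point digit [f] is [p.-1], so adding [p ^ f] carries there. It carries at the point
   before only if that digit is [p.-1] too, which would make [p] divide [a']. *)
have [n n1 en] := solve_affine p_gt1 (digit p (NN lam d) f) p.-1 (etrans (coprime_sym a' p) co).
have [E [nr ap lin]] := near_ap rng n1.
have [mu hmu] := stable (single 0 (p ^ f)).
have f_s : f < s by lia.
have dig m : m < 3 -> digit p (NN lam (E m)) f = (digit p (NN lam d) f + (n - 2 + m) * a') %% p.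
  move=> m3; rewrite (digit_eqmod p_gt1 (lin lam _ m3) f_s) -/a ea.
  by rewrite mulnA [_ * p ^ f]mulnC digit_addM.
have cl m : m < 3 -> NN lam (E m) = NN lam (E 0) %[mod p ^ f].
  move=> m3; rewrite (eqmod_expn_le (ltnW f_s) (lin lam _ m3)) (eqmod_expn_le (ltnW f_s) (lin lam 0 isT)).
  by rewrite -/a ea !mulnA -modnDmr modnMl -[RHS]modnDmr modnMl.
have ct m : m < 3 -> NN (single 0 (p ^ f)) (E m) = NN (single 0 (p ^ f)) (E 0) %[mod p ^ f].
  by rewrite !NN_single0.
have rngf : j <= f < s.-1 by rewrite lejf.
have d1 : digit p (p ^ f) f = 1 by rewrite /digit divnn P0 modn_small.
have := carry_line hmu p_gt2 rngf nr ap cl ct; rewrite !NN_single0 // d1 !dig //.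
rewrite subnK // en (modn_small (_ : p.-1 < p)); last by lia.
rewrite (_ : n = n - 2 + 1 + 1) in en; last by lia.
rewrite (addn1 p.-1) prednK ?leqnn; last by lia.
move: en; rewrite mulnDl addnA mul1n (modn_small (_ : p.-1 < p)); last by lia.
move: (_ + (n - 2 + 1) * a') => x en le.
have ex : x %% p = p.-1 by have := ltn_pmod x (ltnW p_gt1); lia.
have : p %| a'.
  move/eqP: en; rewrite -ex -{2}(addn0 x) eqn_modDl mod0n; exact.
by move: co; rewrite prime_coprime // => /negbTE ->.
Qed.

(** By [kernel_slope] this digit is constant along row 1; were it nonzero, adding a word whose digit
    [f] takes all values there would carry at some points only. *)
Lemma kernel_const f : (1 < s -> 1 < nth 0 ts 0) -> j <= f < s.-1 -> digit p (NN lam d) f = 0.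
Proof.
move=> canon rngf; have /andP[lejf ltf] := rngf.
have head2 : 1 < nth 0 ts 0 by apply: canon; lia.
have rng : 0 < 1 < r.
  by move: head2; case: (ts) => //= x u x1; rewrite (leq_trans x1) ?leq_addr.
set h := digit p _ _; apply/eqP; case: (posnP h) => // h0.
have lth : h < p by apply: ltn_digit.
(* Row 1 takes all values of [Z_(p^s)], as [t_1 >= 2]. *)
pose tau := single 1 (p ^ (f - j)).
(* At the last point digit [f] of [tau] is [p - h], the least that carries when added to [h]; one
   point earlier it is one less. *)
have [n n1 en] := solve_affine p_gt1 (digit p (NN tau d) f) (p - h) (coprime1n p).
have [E [nr ap lin]] := near_ap rng n1.
have [mu hmu] := stable tau.
have f_s : f < s by lia.
have lint m : m < 3 -> NN tau (E m) = NN tau d + p ^ f * (n - 2 + m) %[mod p ^ s].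
  by move=> m3; rewrite lin // /tau /single eqxx mul1n lev0 // -expnD subnK // mulnC.
have dig m : m < 3 -> digit p (NN tau (E m)) f = (digit p (NN tau d) f + (n - 2 + m)) %% p.
  by move=> m3; rewrite (digit_eqmod p_gt1 (lint _ m3) f_s) digit_addM.
have cld m : m < 3 -> NN lam (E m) = NN lam d %[mod p ^ s.-1].
  move=> m3; rewrite (eqmod_expn_le (leq_pred _) (lin lam _ m3)) -modnDmr.
  by have /eqP e := dvdn_mull (n - 2 + m) (kernel_slope rng); rewrite e addn0.
have cl m : m < 3 -> NN lam (E m) = NN lam (E 0) %[mod p ^ f].
  by move=> m3; rewrite !(eqmod_expn_le (ltnW ltf) (cld _ _)).
have ct m : m < 3 -> NN tau (E m) = NN tau (E 0) %[mod p ^ f].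
  move=> m3; rewrite !(eqmod_expn_le (ltnW f_s) (lint _ _)) //.
  by rewrite -modnDmr modnMr -[RHS]modnDmr modnMr.
have := carry_line hmu p_gt2 rngf nr ap cl ct; rewrite !dig // !(digit_eqmod p_gt1 (cld _ _) ltf) // -/h.
rewrite muln1 in en; rewrite subnK // en (modn_small (_ : p - h < p)); last by lia.
rewrite (subnKC (ltnW lth)) leqnn => le.
move: en; rewrite (_ : n = n - 2 + 1 + 1); last by lia.
rewrite addnA; move: (_ + (n - 2 + 1)) le => x le.
rewrite -modnDml (modn_small (_ : p - h < p)); last by lia.
move: le (ltn_pmod x (ltnW p_gt1)); move: (x %% p) => y le ltp.
have [lt|ge] := ltnP (y + 1) p; first by rewrite modn_small //; lia.
have -> : y + 1 = p by lia.
by rewrite modnn; lia.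
Qed.

End KernelWord.
End KernelUpper.

(** * The refinement of a canonical code *)

Section Invariant.
Variables (p t : nat) (ts : seq nat).
Hypothesis p_gt1 : 1 < p.
Hypothesis ts_head : 0 < nth 0 ts 0.
Hypothesis ts_weight : weight ts = t.+1.

Notation s := (size ts).
Notation r := (sumn ts).
Notation lv := (lev ts).
Notation zc := (@zc p t ts p_gt1).
Notation yc := (@yc p t ts).
Notation NN := (@lincomb p t ts p_gt1).
Notation code := (GHcode p t ts).
Notation near := (@near p t ts p_gt1).
Implicit Types (d e : 'I_(p ^ t)).
Let P0 := expnp_gt0 p_gt1.
Let s_gt0 : 0 < s. Proof. exact: size_ts_gt0. Qed.
Hypothesis p_prime : prime p.
Hypothesis p_gt2 : 2 < p.
Hypothesis canon : 1 < s -> 1 < nth 0 ts 0.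

(** [kernel_slope] makes [u] agree at [d] and [d'], and [kernel_const] kills its digits at the
    indices where the positions may differ. *)
Lemma near_refine j d d' : j < s -> near j.+1 d d' -> refine code (near j) d d'.
Proof.
move=> ltjs /nearP[hz hy]; have codeE := GHcodeP p_gt1 ts_head ts_weight.
have nr : near j d d'.
  apply/nearP; split=> [i lti|].
    by apply: eqmod_expn_le (hz i lti); rewrite addnS.
  by apply: eqmod_expn_le hy; rewrite /= leq_pred.
apply/andP; split=> //; apply/forall_inP => x /forall_inP ker.
have wordP lam : [ffun e => gr p s (NN lam e) (yc e)] \in code.
  by apply/codeE; exists lam => e; rewrite ffunE.
(* Added to the zero codeword, [x] must itself agree with a codeword on the class. *)
have [lam xE] : exists lam, forall e, near j d e -> x e = gr p s (NN lam e) (yc e).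
  have /exists_inP[c' /codeE[lam ec'] /forallP h] := ker _ (wordP (fun=> 0)).
  exists lam => e nre; rewrite -ec'; have := implyP (h e) nre; rewrite ffunE.
  by rewrite /lincomb big1 ?gr0 ?add0r // => /eqP ->.
have stable tau : exists mu, forall e, near j d e ->
  (gr p s (NN lam e) (yc e) + gr p s (NN tau e) (yc e) = gr p s (NN mu e) (yc e))%R.
  have /exists_inP[c' /codeE[mu ec'] /forallP h] := ker _ (wordP tau).
  exists mu => e nre; rewrite -ec' -xE // addrC; have := implyP (h e) nre; rewrite ffunE.
  by move/eqP.
have slope := kernel_slope ts_head ts_weight p_prime p_gt2 stable.
have cst f := kernel_const ts_head ts_weight p_prime p_gt2 stable (f := f) canon.
rewrite !xE ?near_refl //; apply/eqP.
have eN : NN lam d = NN lam d' %[mod p ^ s].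
  rewrite /lincomb -[LHS]modn_summ -[RHS]modn_summ; congr (_ %% _); apply: eq_bigr => i _.
  case: (posnP i) => [->|i0]; first by rewrite !zc0.
  (* The modulus of [hz] has one factor [p] more than the one in [slope], which lifts divisibility
     by [p ^ s.-1] to [p ^ s]. *)
  apply: eqmod_mull_dvd (hz i (ltn_ord i)) _.
  have := slope i; rewrite i0 ltn_ord => /(_ isT) dv.
  by rewrite addnS expnSr mulnA -(prednK s_gt0) expnSr dvdn_mul.
rewrite -(gr_eqmod p_gt1 ts_head _ eN) /gr; congr (_ + _)%R; apply: eq_bigr => i _.
case: (ltnP i j) => [lt|ge]; first by rewrite (digit_eqmod p_gt1 hy lt).
by rewrite cst ?ge //= !mul0r.
Qed.

Lemma refine_iterE j : refine_iter code j =2 near j.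
Proof.
elim: j => [|j IH] d d'; first by rewrite near0.
rewrite /= (eq_refine _ IH); case: (ltnP j s) => [lt|ge].
  by apply/idP/idP => [/refine_nearW|/near_refine]; apply.
apply/idP/idP => [/andP[/near_eq -> // _]|/near_eq ->]; rewrite ?near_refl //; last exact: leqW.
by rewrite /refine near_refl; apply/forall_inP => x _.
Qed.

Lemma card_refine_iter j d : 0 < j ->
  #|[set e | refine_iter code j d e]| = p ^ (\sum_(i < s) nth 0 ts i * (s - (i + j))).
Proof.
move=> j0; rewrite -(card_near p_gt1 ts_head ts_weight d j0); apply: eq_card => e.
by rewrite !inE refine_iterE.
Qed.

End Invariant.

(** * Recovering the type from the class sizes *)

Definition canonical ts := (0 < nth 0 ts 0) && ((1 < size ts) ==> (1 < nth 0 ts 0)).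

(** For [j > 0], the exponent of the class size after [j] refinements of a canonical code; for
    [j = 0], the weight. *)
Definition tailsum ts j := \sum_(i < size ts) nth 0 ts i * (size ts - (i + j)).

(** The last nonzero value is at [(size ts).-1], which gives the size. The value at [size ts - i.+1]
    involves only the entries up to [i], that one with coefficient 1, so the system is
    triangular. *)
Lemma tailsum_inj ts ts' : 0 < nth 0 ts 0 -> 0 < nth 0 ts' 0 ->
  tailsum ts =1 tailsum ts' -> ts = ts'.
Proof.
have tail0 u j : size u <= j -> tailsum u j = 0.
  by move=> le; rewrite /tailsum big1 // => i _; rewrite (_ : _ - _ = 0) ?muln0 //; lia.
have tail_gt0 u : 0 < nth 0 u 0 -> 0 < tailsum u (size u).-1.
  case: u => // x u /= x0; rewrite /tailsum big_ord_recl /= addn_gt0.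
  by rewrite muln_gt0 x0 add0n subSnn.
have le_size u v : 0 < nth 0 u 0 -> tailsum u =1 tailsum v -> size u <= size v.
  move=> u0 e; rewrite leqNgt; apply/negP => lt.
  by have := tail_gt0 _ u0; rewrite e tail0 //; lia.
move=> h h' e; have es : size ts = size ts'.
  by apply/eqP; rewrite eqn_leq !le_size // => j.
apply: (@eq_from_nth _ 0) => // i; elim/ltn_ind: i => i IH lti.
have := e (size ts - i.+1); rewrite /tailsum -es.
pose F u k := nth 0 u k * (size ts - (k + (size ts - i.+1))).
have split_sum u : \sum_(k < size ts) nth 0 u k * (size ts - (k + (size ts - i.+1))) =
   \sum_(0 <= k < i) F u k + nth 0 u i.
  rewrite -(big_mkord xpredT (F u)) (big_cat_nat (n := i)) //=; last exact: ltnW.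
  congr (_ + _); rewrite big_ltn // big_nat big1 ?addn0.
    by rewrite /F (_ : _ - _ = 1) ?muln1 //; lia.
  by move=> k /andP[ltk _]; rewrite /F (_ : _ - _ = 0) ?muln0 //; lia.
rewrite !split_sum big_nat [in RHS]big_nat.
rewrite (eq_bigr (F ts')) => [|k /andP[_ ltk]]; first exact: addnI.
by rewrite /F IH // (ltn_trans ltk).
Qed.

Lemma GHcode_equiv_canonical p t ts ts' : prime p -> 2 < p ->
  canonical ts -> canonical ts' -> weight ts = t.+1 -> weight ts' = t.+1 ->
  code_equiv (GHcode p t ts) (GHcode p t ts') -> ts = ts'.
Proof.
move=> pp p2 /andP[h /implyP c] /andP[h' /implyP c'] w w' eqv.
have p1 := prime_gt1 pp; apply: tailsum_inj => // j.
case: (posnP j) => [->|j0].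
  have tw u : tailsum u 0 = weight u.
    by apply: eq_bigr => i _; rewrite addn0 mulnC.
  by rewrite !tw w w'.
(* All classes have the same size, so any coordinate serves. *)
have [pi /(_ (Ordinal (expnp_gt0 p1 t)))] := card_refine_iter_equiv j eqv.
rewrite !(card_refine_iter p1) // => /eqP.
by rewrite eqn_exp2l // => /eqP.
Qed.

(** * Reduction to canonical types *)

Section CodeEquiv.
Variables p N : nat.
Implicit Types C : {set {ffun 'I_N -> 'Z_p}}.

Lemma code_equivP C1 C2 : reflect (exists a : {ffun 'I_N -> 'Z_p}, exists pi : {perm 'I_N},
    C2 = [set a + [ffun k => c (pi k)] | c : {ffun 'I_N -> 'Z_p} in C1]%R)
  (code_equiv C1 C2).
Proof.
apply: (iffP existsP) => -[a h]; exists a.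
  by have /existsP[pi /eqP e] := h; exists pi.
by have [pi e] := h; apply/existsP; exists pi; apply/eqP.
Qed.

Lemma code_equiv_refl C : code_equiv C C.
Proof.
apply/code_equivP; exists 0%R, 1%g; rewrite -[LHS]imset_id; apply: eq_imset => c.
by apply/ffunP => k; rewrite !ffunE perm1 add0r.
Qed.

Lemma code_equiv_sym C1 C2 : code_equiv C1 C2 -> code_equiv C2 C1.
Proof.
case/code_equivP => a [pi ->]; apply/code_equivP.
exists [ffun k => - a ((pi^-1)%g k)]%R, (pi^-1)%g; rewrite -imset_comp -[LHS]imset_id.
by apply: eq_imset => c; apply/ffunP => k; rewrite !ffunE permKV addKr.
Qed.

Lemma code_equiv_trans C1 C2 C3 : code_equiv C1 C2 -> code_equiv C2 C3 -> code_equiv C1 C3.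
Proof.
case/code_equivP => a [pi ->] /code_equivP[b [rho ->]]; apply/code_equivP.
exists (b + [ffun k => a (rho k)])%R, (rho * pi)%g; rewrite -imset_comp.
by apply: eq_imset => c; apply/ffunP => k; rewrite !ffunE permM addrA.
Qed.

End CodeEquiv.

(* The type obtained from [1 :: u] by trading the lowest digit of [y], whose
   coefficient in each codeword is constant, for a row of order [p]. *)
Definition absorb (u : seq nat) := incr_nth (incr_nth u 0) (size u).-1.

Lemma size_absorb u : 0 < size u -> size (absorb u) = size u.
Proof. by case: u => // x u _; rewrite /absorb !size_incr_nth /= ltnSn. Qed.

Lemma sumn_incr_nth_lt u i : i < size u -> sumn (incr_nth u i) = (sumn u).+1.
Proof. by elim: u i => // x u IH [|i] //= /IH ->; rewrite addnS. Qed.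

Lemma sumn_absorb u : 0 < size u -> sumn (absorb u) = (sumn u).+2.
Proof. by case: u => // x u _; rewrite /absorb /= (@sumn_incr_nth_lt (_ :: _)) /=. Qed.

Lemma weight_incr_nth u i : i < size u -> weight (incr_nth u i) = weight u + (size u - i).
Proof.
move=> lt; rewrite /weight size_incr_nth lt.
under eq_bigr do rewrite nth_incr_nth mulnDr.
rewrite big_split /= addnC; congr (_ + _).
rewrite (bigD1 (Ordinal lt)) //= eqxx muln1 big1 ?addn0 // => k.
by rewrite -val_eqE /= eq_sym => /negbTE ->; rewrite muln0.
Qed.

Lemma weight_absorb u : 0 < size u -> weight (absorb u) = weight (1 :: u).
Proof.
move=> u0; rewrite /absorb weight_incr_nth; last by rewrite size_incr_nth u0 prednK.
rewrite weight_incr_nth // size_incr_nth u0 /weight /= big_ord_recl /= subn0 muln1.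
rewrite addnC (_ : _ - _ = 1); last by lia.
by rewrite addnC -addnA addnC addn1 subn0.
Qed.

Lemma head_absorb u : 0 < nth 0 (absorb u) 0.
Proof. by case: u => //= x [|y u]; rewrite /absorb /= ?addn0. Qed.

(** One increment supplies row 0, the other a final row of the highest level, hence of order [p]. *)
Lemma lvls_absorb u : 0 < size u -> lvls (absorb u) = 1 :: rcons (lvls_from 1 u) (size u).
Proof.
have incr_last : forall v i, 0 < size v ->
    lvls_from i (incr_nth v (size v).-1) = rcons (lvls_from i v) (i + (size v).-1).
  elim=> // x v IH i _; case: v IH => [|y v] IH /=.
    by rewrite !cats0 addn0 -cats1 -(nseqD x 1) addn1.
  by have /= -> := IH i.+1 isT; rewrite !rcons_cat addSnnS.
case: u => // x u _; rewrite lvlsE /absorb /=.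
have := incr_last (x.+1 :: u) 1 isT => /= ->.
by rewrite add1n.
Qed.

Lemma lvls_fromS i u : lvls_from i.+1 u = map S (lvls_from i u).
Proof.
elim: u i => //= x u IH i; rewrite map_cat IH; congr (_ ++ _).
by rewrite map_nseq.
Qed.

Lemma lev_absorb u k : 0 < size u -> 0 < k < (sumn u).+1 ->
  lev (1 :: u) k = (lev (absorb u) k).+1.
Proof.
move=> u0 /andP[k0 ltk]; rewrite /lev lvls_absorb // lvlsE /= -(prednK k0) /=.
have sz : size (lvls_from 1 u) = sumn u by rewrite -lvlsE size_lvls.
have ltk' : k.-1 < size (lvls_from 1 u) by rewrite sz; lia.
rewrite lvls_fromS (nth_map 0) // nth_rcons ltk' /=.
have /lvls_range/andP[h _] : nth 0 (lvls_from 1 u) k.-1 \in lvls u by rewrite lvlsE mem_nth.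
by rewrite prednK.
Qed.

Lemma lev_absorb_last u : 0 < size u -> lev (absorb u) (sumn u).+1 = (size u).-1.
Proof.
by move=> u0; rewrite /lev lvls_absorb //= nth_rcons -lvlsE size_lvls ltnn eqxx.
Qed.

Section Absorb.
Variables (p t : nat) (u : seq nat).
Hypothesis p_gt1 : 1 < p.
Hypothesis u_gt0 : 0 < size u.
Hypothesis u_weight : weight (1 :: u) = t.+1.

Let v := absorb u.
Let v_head : 0 < nth 0 v 0. Proof. exact: head_absorb. Qed.
Let v_weight : weight v = t.+1. Proof. by rewrite weight_absorb. Qed.
Let P0 := expnp_gt0 p_gt1.
Notation m := (size u).
Notation r := (sumn u).+1.
Notation zc' := (@zc p t v p_gt1).
Notation zc := (@zc p t (1 :: u) p_gt1).
Notation yc' := (@yc p t v).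
Notation yc := (@yc p t (1 :: u)).

(** Entries below row 0 are multiples of [p] and get divided by it; the lowest digit of the position
    becomes the entry of the new last row. *)
Lemma absorb_point d : exists e : 'I_(p ^ t),
  [/\ forall k, 0 < k < r -> zc d k = p * zc' e k,
      zc' e r = p ^ m.-1 * (yc d %% p) & yc' e = yc d %/ p].
Proof.
have sv := size_absorb u_gt0; have rv : sumn v = r.+1 := sumn_absorb u_gt0.
pose z k := if k == 0 then 1 else if k < r then zc d k %/ p else p ^ m.-1 * (yc d %% p).
have dv k : 0 < k < r -> p ^ (lev v k).+1 %| zc d k.
  move=> rng; rewrite -lev_absorb //; apply: zc_dvd => //.
  by case/andP: rng.
have [|k||e [ez ey]] := @point_ex p t v p_gt1 v_head v_weight z (yc d %/ p).
- by [].
- rewrite rv /z => ltk; case: (posnP k) => [->|k0]; first by rewrite lev0 // dvd1n.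
  case: (ltnP k r) => [lt|ge].
    have := dv k; rewrite k0 lt => /(_ isT) /dvdnP[q ->].
    by rewrite expnSr mulnA mulnK ?dvdn_mull // (ltnW p_gt1).
  by have -> : k = r; [lia | rewrite lev_absorb_last // dvdn_mulr].
- rewrite sv ltn_divLR; last exact: ltnW.
  by rewrite -expnSr prednK //; apply: (yc_lt (1 :: u)).
exists e; split=> // [k rng|]; last first.
  rewrite ez ?rv // /z ltnn /= modn_small // sv -{2}(prednK u_gt0) expnSr ltn_mul2l P0.
  by rewrite ltn_mod (ltnW p_gt1).
have /andP[k0 lt] := rng; have ltv : k < sumn v by rewrite rv ltnW.
rewrite (ez _ ltv) /z (gtn_eqF k0) lt.
have pd : p %| zc d k by apply: dvdn_trans (dv _ rng); rewrite expnS dvdn_mulr.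
have lt2 : zc d k %/ p < p ^ size v.
  by rewrite sv ltn_divLR ?(ltnW p_gt1) // -expnSr; apply: (zc_lt (1 :: u)).
by rewrite (modn_small lt2) mulnC divnK.
Qed.

(** The product of the lowest digits of [u] and [y] turns into a contribution to the top digit, and
    all other digits move down by one. *)
Lemma gr_absorb M b l y : b = l %[mod p] -> b < p ->
  gr p m.+1 (p * M + b) y = gr p m (M + l * (p ^ m.-1 * (y %% p))) (y %/ p).
Proof.
move=> eb ltb.
have -> : l * (p ^ m.-1 * (y %% p)) = p ^ m.-1 * (l * (y %% p)) by rewrite mulnCA.
rewrite gr_addtop // natrM -(eqmod_natr_Zp p_gt1 eb).
have dS i : digit p (p * M + b) i.+1 = digit p M i.
  by rewrite -digit_div mulnC divnMDl ?(ltnW p_gt1) // divn_small // addn0.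
have d0 : digit p (p * M + b) 0 = b.
  by rewrite /digit expn0 divn1 mulnC modnMDl modn_small.
have dy : digit p y 0 = y %% p by rewrite /digit expn0 divn1.
rewrite /gr /=; case: (m) u_gt0 => // n _ /=.
rewrite big_ord_recl /= d0 dy dS -!addrA; congr (_ + _)%R; rewrite addrC; congr (_ + _)%R.
by apply: eq_bigr => i _; rewrite /bump /= add1n dS digit_div.
Qed.

Lemma GHcode_absorb : code_equiv (GHcode p t v) (GHcode p t (1 :: u)).
Proof.
have sv : size v = m := size_absorb u_gt0; have rv : sumn v = r.+1 := sumn_absorb u_gt0.
have [f fP] := fin_all_exists absorb_point.
have f_inj : injective f.
  move=> d e efd; have [zd ld yd] := fP d; have [ze le ye] := fP e.
  apply: (@point_inj p t (1 :: u) p_gt1) => // [k ltk|].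
    by case: (posnP k) => [->|k0]; rewrite ?zc0 // zd ?ze ?efd // k0.
  have /eqP : p ^ m.-1 * (yc d %% p) = p ^ m.-1 * (yc e %% p) by rewrite -ld -le efd.
  rewrite eqn_pmul2l // => /eqP em.
  by rewrite (divn_eq (yc d) p) (divn_eq (yc e) p) em -yd -ye efd.
(* The lowest digit of the coefficient of row 0 becomes the coefficient of the new last row. *)
have word lam lam' : lam 0 = p * lam' 0 + lam' r %% p ->
    (forall k, 0 < k < r -> lam k = lam' k) -> forall d,
    gr p m.+1 (lincomb (1 :: u) p_gt1 lam d) (yc d) = gr p m (lincomb v p_gt1 lam' (f d)) (yc' (f d)).
  move=> e0 ek d; have [zd ld yd] := fP d.
  pose M := lam' 0 + \sum_(1 <= k < r) lam' k * zc' (f d) k.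
  have -> : lincomb (1 :: u) p_gt1 lam d = p * M + lam' r %% p.
    rewrite /lincomb -(big_mkord xpredT (fun k => lam k * zc d k)) big_ltn //= zc0 // muln1 e0.
    rewrite /M mulnDr addnAC; congr (_ + _ + _); rewrite big_distrr /= big_nat [in RHS]big_nat.
    by apply: eq_bigr => k rng; rewrite zd // ek // mulnCA.
  have -> : lincomb v p_gt1 lam' (f d) = M + lam' r * (p ^ m.-1 * (yc d %% p)).
    rewrite /lincomb -(big_mkord xpredT (fun k => lam' k * zc' (f d) k)) rv big_nat_recr //= ld.
    by congr (_ + _); rewrite big_ltn // zc0 // muln1.
  by rewrite yd; apply: gr_absorb; rewrite ?modn_mod // ltn_mod (ltnW p_gt1).
apply/code_equivP; exists 0%R, (perm f_inj).
have codeE := GHcodeP p_gt1 (isT : 0 < nth 0 (1 :: u) 0) u_weight.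
have codeE' := GHcodeP p_gt1 v_head v_weight.
rewrite sv in codeE'.
apply/setP => c; apply/idP/imsetP => [/codeE[lam ec]|[c' /codeE'[lam' ec'] ->]].
  pose lam' k := if k == 0 then lam 0 %/ p else if k == r then lam 0 %% p else lam k.
  exists [ffun k => gr p m (lincomb v p_gt1 lam' k) (yc' k)].
    by apply/codeE'; exists lam' => k; rewrite ffunE.
  apply/ffunP => k; rewrite !ffunE permE add0r ec; apply: word.
    by rewrite /lam' /= eqxx modn_mod [p * _]mulnC -divn_eq.
  by move=> i /andP[i0 lti]; rewrite /lam' (gtn_eqF i0) (ltn_eqF lti).
apply/codeE; exists (fun k => if k == 0 then p * lam' 0 + lam' r %% p else lam' k) => k.
rewrite !ffunE permE add0r ec' -(word (fun k => if k == 0 then p * lam' 0 + lam' r %% p else lam' k)) //.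
by move=> i /andP[i0 _]; rewrite (gtn_eqF i0).
Qed.

End Absorb.

(** A non-canonical type is [1 :: u] with [u] nonempty, and [absorb u] is one entry shorter, so the
    process ends. *)
Lemma GHcode_canonicalize p t ts : 1 < p -> 0 < nth 0 ts 0 -> weight ts = t.+1 ->
  exists ts', [/\ canonical ts', weight ts' = t.+1 & code_equiv (GHcode p t ts) (GHcode p t ts')].
Proof.
move=> p1; have [n] := ubnP (size ts); elim: n ts => // n IH ts lts h w.
case c : (canonical ts); first by exists ts; split=> //; apply: code_equiv_refl.
have [u e u0] : exists2 u, ts = 1 :: u & 0 < size u.
  move: c h; rewrite /canonical; case: (ts) => //= x u /nandP[]; rewrite ?ltnS; first by case: x.
  by rewrite negb_imply => /andP[u0]; case: x => // -[] // _ _; exists u.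
rewrite e in w lts *.
have [||ts' [c' w' q]] := IH (absorb u) _ (head_absorb u); rewrite ?size_absorb ?weight_absorb //.
exists ts'; split=> //; apply: code_equiv_trans q; apply: code_equiv_sym.
exact: GHcode_absorb.
Qed.

Lemma absorb_linear n q : absorb (0 :: rcons (nseq n 0) q) = 1 :: rcons (nseq n 0) q.+1.
Proof.
rewrite /absorb /= size_rcons size_nseq; congr (_ :: _).
by elim: n => //= n ->.
Qed.

Lemma weight_linear n q : weight (1 :: rcons (nseq n 0) q) = (n + q).+2.
Proof.
elim: n q => [|n IH] q; first by rewrite /weight !big_ord_recl big_ord0 /= /bump /=; lia.
by rewrite /= -weight_absorb // absorb_linear IH addnS.
Qed.

(** Each absorption removes a zero and raises the last entry, ending with the linear code. *)
Lemma GHcode_linear p t n q : 1 < p -> (n + q).+1 = t ->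
  code_equiv (GHcode p t (1 :: rcons (nseq n 0) q)) (GHcode p t [:: t.+1]).
Proof.
move=> p1; elim: n q => [|n IH] q e.
  (* Both increments fall on the only entry of [[:: q]], giving [[:: q.+2]]. *)
  by rewrite -e; apply/code_equiv_sym/(@GHcode_absorb p _ [:: q]); rewrite // (weight_linear 0).
have /code_equiv_trans : code_equiv (GHcode p t (1 :: rcons (nseq n.+1 0) q))
    (GHcode p t (1 :: rcons (nseq n 0) q.+1)).
  rewrite -absorb_linear; apply/code_equiv_sym/GHcode_absorb => //.
  exact: etrans (weight_linear n.+1 q) (congr1 S e).
by apply; apply: IH; rewrite addnS -e.
Qed.

(** * Counting equivalence classes *)

Section Classes.
Variables (p N : nat) (T : eqType) (G : T -> {set {ffun 'I_N -> 'Z_p}}).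
Variables (F : {set {set {ffun 'I_N -> 'Z_p}}}) (L : seq T).
Hypothesis G_in : forall x, x \in L -> G x \in F.

Let cl C := [set D in F | code_equiv C D].

Lemma nclasses_ge : uniq L ->
  {in L &, forall x y, code_equiv (G x) (G y) -> x = y} -> size L <= nclasses F.
Proof.
move=> uL inj.
have uc : uniq (map (cl \o G) L).
  rewrite map_inj_in_uniq // => x y xL yL /= /setP /(_ (G y)).
  rewrite !inE G_in // code_equiv_refl /=; exact: inj.
rewrite -(size_map (cl \o G)) -(card_uniqP uc); apply: subset_leq_card.
apply/subsetP => X /mapP[x xL ->] /=; apply/imsetP; exists (G x) => //.
exact: G_in.
Qed.

Lemma nclasses_le : (forall C, C \in F -> exists2 x, x \in L & code_equiv C (G x)) ->
  nclasses F <= size L.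
Proof.
move=> cover; rewrite -(size_map (cl \o G)).
apply: leq_trans (card_size _); apply: subset_leq_card; apply/subsetP => X.
case/imsetP => C CF ->; have [x xL e] := cover _ CF; apply/mapP; exists x => //=.
apply/setP => D; rewrite !inE; congr (_ && _); apply/idP/idP.
  exact/code_equiv_trans/code_equiv_sym.
exact: code_equiv_trans.
Qed.

End Classes.

(** * Enumerating the canonical types *)

Lemma tuple_ord_ex n ts : all (fun x => x < n) ts ->
  exists x : (size ts).-tuple 'I_n, map val x = ts.
Proof.
elim: ts => [|a u IH] /=; first by exists [tuple].
by case/andP=> lta /IH[x e]; exists [tuple of Ordinal lta :: x]; rewrite /= e.
Qed.

(** Every coefficient in the weight is positive; hence bounding the entries by [t + 2] loses no
    type. *)
Lemma weight_bound ts n : weight ts <= n -> all (fun x => x < n.+1) ts.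
Proof.
move=> w; apply/(all_nthP 0) => i lti; rewrite ltnS; apply: leq_trans w.
rewrite /weight (bigD1 (Ordinal lti)) //=; apply: leq_trans (leq_addr _ _).
by rewrite leq_pmull // subn_gt0.
Qed.

Lemma tuple_weight_ex t ts : weight ts = t.+1 ->
  exists x : (size ts).-tuple 'I_(t + 2), map val x = ts.
Proof. by move=> w; apply: tuple_ord_ex; rewrite addn2 weight_bound ?w. Qed.

Lemma GHfamP p t s C : reflect (exists ts, [/\ size ts = s, 0 < nth 0 ts 0, weight ts = t.+1
  & C = GHcode p t ts]) (C \in GHfam p t s).
Proof.
rewrite inE; apply: (iffP existsP) => [[x /and3P[h /eqP w /eqP ->]]|[ts [<- h w ->]]].
  by exists (map val x); split=> //; rewrite size_map size_tuple.
by have [x e] := tuple_weight_ex w; exists x; rewrite e h w !eqxx.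
Qed.

Lemma GHfam_allP p t C : 1 < p -> reflect (exists ts, [/\ 0 < nth 0 ts 0, weight ts = t.+1
  & C = GHcode p t ts]) (C \in GHfam_all p t).
Proof.
move=> p1; rewrite inE; apply: (iffP existsP) => [[s /andP[_ /GHfamP[ts [_ h w e]]]]|[ts [h w e]]].
  by exists ts.
have s0 := size_ts_gt0 h; have le := size_le_t p1 h w.
have lt : size ts < t + 2 by lia.
by exists (Ordinal lt); rewrite s0; apply/GHfamP; exists ts.
Qed.

Definition Xlist t s : seq (seq nat) :=
  [seq map val x | x : s.-tuple 'I_(t + 2) <- enum [set ts : s.-tuple 'I_(t + 2) |
      (2 <= nth 0 (map val ts) 0) && (weight (map val ts) == t.+1)]].

Lemma size_Xlist t s : size (Xlist t s) = Xtilde t s.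
Proof. by rewrite size_map -cardE. Qed.

Lemma Xlist_uniq t s : uniq (Xlist t s).
Proof.
by rewrite map_inj_uniq ?enum_uniq // => x y /(inj_map val_inj)/val_inj.
Qed.

Lemma mem_Xlist t s ts :
  (ts \in Xlist t s) = [&& size ts == s, 1 < nth 0 ts 0 & weight ts == t.+1].
Proof.
apply/mapP/and3P => [[x]|[/eqP <- h /eqP w]].
  by rewrite mem_enum inE => /andP[h w ->]; rewrite size_map size_tuple.
by have [x e] := tuple_weight_ex w; exists x; rewrite ?mem_enum ?inE e ?h ?w ?eqxx.
Qed.

Definition canonical_list t : seq (seq nat) :=
  [:: t.+1] :: flatten [seq Xlist t s | s <- index_iota 2 (t.+1)./2.+1].

Lemma size_canonical_list t :
  size (canonical_list t) = 1 + \sum_(2 <= s < (t.+1)./2.+1) Xtilde t s.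
Proof.
rewrite /= size_flatten sumnE /shape -map_comp big_map add1n; congr _.+1.
by apply: eq_bigr => s _; rewrite /= size_Xlist.
Qed.

Lemma weight_geq ts : size ts * nth 0 ts 0 <= weight ts.
Proof.
case: ts => // x u; rewrite /weight big_ord_recl /= subn0; exact: leq_addr.
Qed.

Lemma weight1 x : weight [:: x] = x.
Proof. by rewrite /weight big_ord1 /= mul1n. Qed.

Lemma mem_canonical_list t ts :
  (ts \in canonical_list t) = canonical ts && (weight ts == t.+1).
Proof.
rewrite inE; apply/orP/andP => [[/eqP ->|/flatten_mapP[s]]|[/andP[h /implyP c] /eqP w]].
- by rewrite weight1.
- rewrite mem_index_iota mem_Xlist /canonical => _ /and3P[_ h ->].
  by rewrite h implybT ltnW.
- have s0 := size_ts_gt0 h; case: (ltnP 1 (size ts)) => [s1|le].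
    right; apply/flatten_mapP; exists (size ts); last by rewrite mem_Xlist eqxx c ?w ?eqxx.
    (* From [t_1 >= 2] and [size ts * t_1 <= t.+1], the size is at most [(t.+1)./2]. *)
    rewrite mem_index_iota s1 ltnS /=; have := weight_geq ts; rewrite w.
    have := c s1; nia.
  left; move: w le s0; case: (ts) => [|x [|y u]] // w _ _; move: w.
  by rewrite weight1 => ->.
Qed.

Lemma canonical_list_uniq t : uniq (canonical_list t).
Proof.
rewrite /=; apply/andP; split.
  apply/negP => /flatten_mapP[s]; rewrite mem_index_iota mem_Xlist /=.
  by case/andP=> s2 _ /and3P[/eqP e]; rewrite -e in s2.
have : uniq (index_iota 2 (t.+1)./2.+1) by apply: iota_uniq.
elim: (index_iota _ _) => //= s l IH /andP[sl /IH ul].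
rewrite cat_uniq Xlist_uniq ul andbT /=; apply/hasPn => x /flatten_mapP[s' s'l].
rewrite !mem_Xlist => /and3P[/eqP e' _ _]; apply/negP => /and3P[/eqP e _ _].
by rewrite -e e' s'l in sl.
Qed.

(** Canonical types represent each class exactly once: [GHcode_canonicalize] gives existence,
    [GHcode_equiv_canonical] uniqueness. *)
Lemma A_tE p t : prime p -> 2 < p -> A_t p t = 1 + \sum_(2 <= s < (t.+1)./2.+1) Xtilde t s.
Proof.
move=> pp p2; have p1 := prime_gt1 pp.
have G_in x : x \in canonical_list t -> GHcode p t x \in GHfam_all p t.
  rewrite mem_canonical_list => /andP[/andP[h _] /eqP w].
  by apply/GHfam_allP => //; exists x.
rewrite -size_canonical_list /A_t; apply/eqP; rewrite eqn_leq; apply/andP; split.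
  apply: (@nclasses_le _ _ _ (GHcode p t)) => C /(GHfam_allP _ p1)[ts [h w ->]].
  have [ts' [c' w' e]] := GHcode_canonicalize p1 h w.
  by exists ts' => //; rewrite mem_canonical_list c' w' eqxx.
apply: (nclasses_ge G_in (canonical_list_uniq t)) => x y.
rewrite !mem_canonical_list => /andP[cx /eqP wx] /andP[cy /eqP wy].
exact: GHcode_equiv_canonical.
Qed.

(** Besides the types with [t_1 >= 2], size [s] has a type whose code is equivalent to the linear
    one; its canonical form has size 1, so it adds a further class. *)
Lemma Xtilde_lt_A_ts p t s : prime p -> 2 < p -> 1 < s <= t.+1 -> Xtilde t s < A_ts p t s.
Proof.
move=> pp p2 /andP[s2 st]; have p1 := prime_gt1 pp.
pose lin := 1 :: rcons (nseq (s - 2) 0) (t.+1 - s).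
have wlin : weight lin = t.+1 by rewrite weight_linear; lia.
have elin : code_equiv (GHcode p t lin) (GHcode p t [:: t.+1]) by apply: GHcode_linear => //; lia.
have lin1 : canonical [:: t.+1] by [].
have Xcan x : x \in Xlist t s -> [/\ size x = s, canonical x & weight x = t.+1].
  rewrite mem_Xlist /canonical => /and3P[/eqP sx h /eqP w].
  by rewrite h implybT ltnW.
have linX x : x \in Xlist t s -> code_equiv (GHcode p t lin) (GHcode p t x) -> False.
  case/Xcan => sx cx wx e; have := code_equiv_trans (code_equiv_sym elin) e.
  move/(GHcode_equiv_canonical pp p2 lin1 cx (weight1 _) wx) => ex.
  by rewrite -sx -ex in s2.
rewrite -size_Xlist /A_ts; apply: (@nclasses_ge _ _ _ (GHcode p t) _ (lin :: Xlist t s)).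
- move=> x; rewrite inE => /orP[/eqP ->|/Xcan[sx /andP[h _] wx]]; apply/GHfamP.
    by exists lin; split=> //; rewrite /= size_rcons size_nseq; lia.
  by exists x.
- by rewrite /= Xlist_uniq andbT; apply/negP => /linX; apply; apply: code_equiv_refl.
- move=> x y; rewrite !inE => /orP[/eqP ->|xX] /orP[/eqP ->|yX] // e.
  + by case: (linX _ yX).
  + by case: (linX _ xX); apply: code_equiv_sym.
  + have [_ cx wx] := Xcan _ xX; have [_ cy wy] := Xcan _ yX.
    exact: (GHcode_equiv_canonical pp p2 cx cy wx wy).
Qed.

Theorem theorem5 (p t : nat) :
  prime p -> (3 <= p)%N -> (3 <= t)%N ->
  [/\ (A_t p t <= 1 + \sum_(2 <= s < (t.+1)./2.+1) Xtilde t s)%N,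
      (A_t p t <= 1 + \sum_(2 <= s < (t.+1)./2.+1) (A_ts p t s - 1))%N
    & (t <= 10)%N -> A_t p t = (1 + \sum_(2 <= s < (t.+1)./2.+1) Xtilde t s)%N].
Proof.
move=> pp p3 _; rewrite A_tE //; split=> //.
rewrite leq_add2l big_nat [leqRHS]big_nat; apply: leq_sum => s /andP[s2 les].
have := @Xtilde_lt_A_ts p t s pp p3; rewrite s2; move: les; rewrite ltnS => les.
have -> : s <= t.+1 by lia.
by move=> /(_ isT); lia.
Qed.
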